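(* Let $K\subset F_1$ be functional differential fields of meromorphic functions on a connected Riemann surface $U$ equipped with a non-constant meromorphic function $x$, where $F_1$ is obtained from $K$ by adjoining functions $$y_1=\ln a_1,\dots,y_k=\ln a_k,\quad z_1=\exp b_1,\dots,z_n=\exp b_n$$ that are algebraically independent over $K$, with $a_1,\dots,a_k,b_1,\dots,b_n\in K$. Let $\gamma:U\to\mathbb C^k\times(\mathbb C^* )^n$ be the map $\gamma(p)=(y_1(p),\dots,y_k(p),z_1(p),\dots,z_n(p))$, let $X=U\times\mathbb C^k\times(\mathbb C^* )^n$, and let $\Gamma\subset X$ be the graph of $\gamma$. Let $\Phi$ be a logarithmic type germ at a point $a=(p_0,\gamma(p_0))\in\Gamma$. Then the germ of the function $p\mapsto\Phi(p,\gamma(p))$ at the point $p_0\in U$ is a germ of an integral over $K$ if and only if $\Phi$ is representable in the form $$ \Phi(p,y,z)=\Phi(p,\gamma(p_0))+\sum_{i=1}^k c_i\,(y_i-y_i(p_0))+\sum_{j=1}^n t_j\ln\frac{z_j}{z_j(p_0)}, $$ where $c_1,\dots,c_k,t_1,\dots,t_n$ are complex constants.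
   Context: **Functional differential field.** Let $U$ be a connected Riemann surface and $x$ a non-constant meromorphic function on $U$. The meromorphic functions on $U$ form a differential field with derivation $f\mapsto f'=df/dx$. A functional differential field is a subfield closed under the derivation and containing all complex constants. For $a,b\in K$, ''$y=\ln a$'' and ''$z=\exp b$'' denote meromorphic functions on $U$ that are a logarithm of $a$ and an exponential of $b$ (so $y'=a'/a$, $z'=b'z$). **Integral over $K$.** A germ of a function $h$ at $p_0\in U$ is a germ of an integral over $K$ if $dh/dx$ is the germ at $p_0$ of a function from $K$. **Coordinates.** On $X=U\times\mathbb C^k\times(\mathbb C^* )^n$ points are written $(p,y,z)$ with $y=(y_1,\dots,y_k)$, $z=(z_1,\dots,z_n)$; the symbols $y_i,z_j$ denote both the coordinate functions on $\mathbb C^k\times(\mathbb C^* )^n$ and the components $y_i(p),z_j(p)$ of $\gamma(p)$. **Logarithmic type germ.** A germ $\Phi$ of a complex-valued function at $a\in X$ is of logarithmic type if $\Phi=R_0+\sum_{i=1}^q\lambda_i\ln R_i$, where $R_0,\dots,R_q$ are germs at $a$ of rational functions of $(y_1,\dots,y_k,z_1,\dots,z_n)$ with coefficients in $K$ (regular at $a$, with $R_1,\dots,R_q$ nonvanishing at $a$, and $\ln$ denoting some analytic branch), and $\lambda_1,\dots,\lambda_q\in\mathbb C$. The branch of $\ln (z_j/z_j(p_0))$ is the one vanishing at $z_j=z_j(p_0)$. *)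

(* Defs.v *)
(* MathComp-Analysis, with the complex numbers R[i] over any R : realType. *)
From HB Require Import structures.
From mathcomp Require Import all_boot all_order all_algebra.
From mathcomp Require Import all_classical all_reals all_analysis.
From mathcomp Require Import complex.
Set Implicit Arguments.
Unset Strict Implicit.
Unset Printing Implicit Defensive.
Import Order.TTheory GRing.Theory Num.Theory.
Import numFieldNormedType.Exports.
Local Open Scope classical_set_scope.
Local Open Scope ring_scope.

(* R[i] packed as a numClosedFieldType, so that it gets the topology, norm and
   (complex) differentiation that the library attaches to every numFieldType. *)
Definition Cplx (R : realType) : numClosedFieldType := R[i].

Definition expC (R : realType) (w : Cplx R) : Cplx R :=
  let w' : R[i] := w in
  Complex (expR (complex.Re w') * cos (complex.Im w'))
          (expR (complex.Re w') * sin (complex.Im w')).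

(* L restricts, on some neighbourhood of w0, to an analytic branch of ln. *)
Definition ln_branch (R : realType) (w0 : Cplx R) (L : Cplx R -> Cplx R)
    : Prop :=
  \forall w \near w0, derivable L w 1 /\ expC (L w) = w.

(* [chart_inv] is only meaningful on the open set [chart_map @` chart_dom]. *)
Record chart (R : realType) (U : topologicalType) := Chart {
  chart_dom : set U;
  chart_map : U -> Cplx R;
  chart_inv : Cplx R -> U;
  chart_dom_open : open chart_dom;
  chart_img_open : open (chart_map @` chart_dom);
  chart_mapK : forall p, chart_dom p -> chart_inv (chart_map p) = p;
  chart_map_cont : forall p, chart_dom p -> {for p, continuous chart_map};
  chart_inv_cont : forall p, chart_dom p ->
    {for chart_map p, continuous chart_inv} }.

Record riemannSurface (R : realType) := RiemannSurface {
  rs_space :> topologicalType;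
  rs_hausdorff : hausdorff_space rs_space;
  rs_atlas : set (chart R rs_space);
  rs_cover : forall p : rs_space, exists2 c, rs_atlas c & chart_dom c p;
  rs_transition : forall c d, rs_atlas c -> rs_atlas d ->
    forall p, chart_dom c p -> chart_dom d p ->
    derivable (chart_map d \o chart_inv c) (chart_map c p) 1 }.

Section Meromorphic.
Variables (R : realType) (U : riemannSurface R).
Local Notation C := (Cplx R).

Definition cdiff_at (h : U -> C) (p : U) : Prop :=
  forall c, rs_atlas c -> chart_dom c p ->
    derivable (h \o chart_inv c) (chart_map c p) 1.

(* A meromorphic function is encoded with value None exactly at its poles, so
   that equal meromorphic functions are equal as Rocq functions. *)
Definition merofun := U -> option C.

Definition mval (f : merofun) (p : U) : C := odflt 0 (f p).

Definition regular_at (f : merofun) (p : U) : Prop := f p <> None.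

Definition mfin (h : U -> C) : merofun := fun p => Some (h p).

Definition meromorphic (f : merofun) : Prop :=
  forall p,
    (regular_at f p ->
       \forall q \near p, regular_at f q /\ cdiff_at (mval f) q) /\
    (~ regular_at f p ->
       (\forall q \near p^', regular_at f q) /\
       forall M : R, \forall q \near p^', (M%:C)%C < `|mval f q| :> C).

Definition nonconstant (f : merofun) : Prop := exists p q, f p <> f q.

(* g = df/dx at p, expressed as df = g dx so as to include the zeros of dx. *)
Definition deriv_at (x f g : merofun) (p : U) : Prop :=
  regular_at x p -> regular_at f p -> regular_at g p ->
  forall c, rs_atlas c -> chart_dom c p ->
    derive1 (mval f \o chart_inv c) (chart_map c p)
    = mval g p * derive1 (mval x \o chart_inv c) (chart_map c p).

(* Sums, products, ... of meromorphic functions are determined by their values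
   away from the poles of the operands, which form a closed discrete set. *)
Record mero_subfield (K : set merofun) : Prop := MeroSubfield {
  msf_mero : forall f, K f -> meromorphic f;
  msf_one : K (mfin (cst 1));
  msf_opp : forall f, K f -> exists2 s, K s &
    forall p u, f p = Some u -> s p = Some (- u);
  msf_add : forall f g, K f -> K g -> exists2 s, K s &
    forall p u v, f p = Some u -> g p = Some v -> s p = Some (u + v);
  msf_mul : forall f g, K f -> K g -> exists2 s, K s &
    forall p u v, f p = Some u -> g p = Some v -> s p = Some (u * v);
  msf_inv : forall f, K f -> f <> mfin (cst 0) -> exists2 s, K s &
    forall p u, f p = Some u -> u != 0 -> s p = Some u^-1 }.

Record functional_differential_field (x : merofun) (K : set merofun)
  : Prop := FunctionalDifferentialField {
  fdf_subfield : mero_subfield K;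
  fdf_const : forall w : C, K (mfin (cst w));
  fdf_deriv : forall f, K f -> exists2 g, K g & forall p, deriv_at x f g p }.

Definition obtained_by_adjoining (K S F : set merofun) : Prop :=
  [/\ mero_subfield F, K `<=` F, S `<=` F &
      forall L, mero_subfield L -> K `<=` L -> S `<=` L -> F `<=` L].

(* dh/dx and f are compared as germs at p0 of meromorphic functions (p0 may be a
   pole of f or x, or a zero of dx), hence on a punctured neighbourhood. *)
Definition germ_of_integral (x : merofun) (K : set merofun) (h : U -> C)
    (p0 : U) : Prop :=
  (\forall p \near p0, cdiff_at h p) /\
  exists2 f, K f & \forall p \near p0^', deriv_at x (mfin h) f p.

Section Coordinates.
Variables k n : nat.

(* U x C^k x C^n. It contains X = U x C^k x (C^* )^n as an open subset, so germs
   at points of X are the same for both. *)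
Definition coord_space : Type := (U * ('rV[C]_k * 'rV[C]_n))%type.

Definition graph_map (y : 'I_k -> U -> C) (z : 'I_n -> U -> C) (p : U)
    : 'rV[C]_k * 'rV[C]_n :=
  (\row_i y i p, \row_j z j p).

(* Polynomials in (y, z) of degree < d in each variable: the coefficient of
   \prod_i y_i ^ (e i) * \prod_j z_j ^ (e' j) is [P e e']. *)
Definition mpolyfun (d : nat) :=
  {ffun 'I_k -> 'I_d} -> {ffun 'I_n -> 'I_d} -> merofun.

(* Only meaningful where all the coefficients are regular. *)
Definition poly_eval (d : nat) (P : mpolyfun d) (w : coord_space) : C :=
  \sum_(e : {ffun 'I_k -> 'I_d}) \sum_(e' : {ffun 'I_n -> 'I_d})
    mval (P e e') w.1 * (\prod_(i < k) w.2.1 0 i ^+ e i)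
                      * (\prod_(j < n) w.2.2 0 j ^+ e' j).

Definition alg_independent (K : set merofun) (y : 'I_k -> U -> C)
    (z : 'I_n -> U -> C) : Prop :=
  forall (d : nat) (P : mpolyfun d),
    (forall e e', K (P e e')) ->
    (forall p, (forall e e', regular_at (P e e') p) ->
       poly_eval P (p, graph_map y z p) = 0) ->
    forall e e', P e e' = mfin (cst 0).

(* A rational function over K regular at a is one that can be written P / Q with
   coefficients regular at the base point of a and with Q(a) != 0. *)
Definition regular_rational_germ (K : set merofun) (a : coord_space)
    (Rf : coord_space -> C) : Prop :=
  exists d (P Q : mpolyfun d),
    [/\ forall e e', [/\ K (P e e'), K (Q e e'),
                         regular_at (P e e') a.1 & regular_at (Q e e') a.1],
        poly_eval Q a != 0 &
        \forall w \near a, Rf w = poly_eval P w / poly_eval Q w].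

Definition logarithmic_type (K : set merofun) (a : coord_space)
    (Phi : coord_space -> C) : Prop :=
  exists (q : nat) (R0 : coord_space -> C) (Rs : 'I_q -> coord_space -> C)
         (lam : 'I_q -> C) (L : 'I_q -> C -> C),
    [/\ regular_rational_germ K a R0,
        forall i, [/\ regular_rational_germ K a (Rs i), Rs i a != 0 &
                      ln_branch (Rs i a) (L i)] &
        \forall w \near a, Phi w = R0 w + \sum_(i < q) lam i * L i (Rs i w)].

End Coordinates.
End Meromorphic.

(* Main.v *)
(* Write X_i for the coordinates y_i, z_j. Along the graph, X_i' = A_i w_i with A_i in K and
   w_i = 1 for a logarithm, w_i = z_j for an exponential, so there is a derivation D on
   K(y, z) with D(R)(p, gamma(p)) = d/dx R(p, gamma(p)). A germ Phi of logarithmic type has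
   partial derivatives in K(y, z), hence D Phi is in K(y, z). If Phi restricted to the graph
   is an integral of f in K, then D Phi = f on the graph, and by algebraic independence
   D Phi = f identically. Moreover D commutes with the translations of C^k x (C^* )^n, so
   Phi(p, translate of gamma(p)) - Phi(p, gamma(p)) has derivative f - f = 0 in p; letting
   the translation tend to the identity, w_i dPhi/dX_i is constant on the graph, hence
   constant. Integrating along vertical segments gives the stated form.

   No power series expansion of holomorphic functions is used: every function to which an
   identity theorem is applied belongs to the field F1, where f * f^-1 takes only the values
   0 and 1 and is therefore constant on the connected surface. If dx vanished on an open
   set, the elements of F1 would be locally, hence globally, constant. *)
Require Import Defs.
From HB Require Import structures.
From mathcomp Require Import all_boot all_order all_algebra.
From mathcomp Require Import all_classical all_reals all_analysis.
From mathcomp Require Import complex.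
From mathcomp Require Import ring lra.
Set Implicit Arguments.
Unset Strict Implicit.
Unset Printing Implicit Defensive.
Import Order.TTheory GRing.Theory Num.Theory.
Import numFieldNormedType.Exports.
Local Open Scope classical_set_scope.
Local Open Scope ring_scope.

(** The main obstacle is the base point. The coefficients of a logarithmic germ are regular at [p0],
    but their derivatives with respect to x may have poles there, because dx may vanish or x may
    have a pole at [p0]. Identities between derivatives are therefore asserted only over a punctured
    neighbourhood of [p0], times a ball in the fiber whose radius does not depend on the base point.
    Most arguments then pick a nearby p where everything is regular on a full neighbourhood, and
    algebraic independence carries the result from p back to [p0]. The fiber over [p0] itself is
    recovered at the end from the continuity of [Phi]. Nothing is ever divided by dx. Identities are
    multiplied by the derivative of x in a chart, and this factor is cancelled only between rational
    germs on the graph, using that dx vanishes on no open set. In the converse direction the term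
    [Phi(p, gamma(p0))] must also be an integral over K. Its derivative is a rational function over
    K evaluated at the constants [gamma(p0)]; since K contains all constants, that value is again in
    K. *)

Lemma near_all (T : topologicalType) (x : T) (I : finType) (A : I -> T -> Prop) :
  (forall i, \forall q \near x, A i q) -> \forall q \near x, forall i, A i q.
Proof. exact: filter_forall. Qed.

Lemma dnbhs_all (T : topologicalType) (x : T) (I : finType) (A : I -> T -> Prop) :
  (forall i, \forall q \near x^', A i q) -> \forall q \near x^', forall i, A i q.
Proof. exact: filter_forall. Qed.

Lemma continuous_near (S T : topologicalType) (f : S -> T) s (A : T -> Prop) :
  {for s, continuous f} -> (\forall q \near f s, A q) -> \forall u \near s, A (f u).
Proof. by move=> fc; apply: fc. Qed.

Lemma near_and (T : topologicalType) (x : T) (A B : T -> Prop) :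
  (\forall q \near x, A q) -> (\forall q \near x, B q) ->
  \forall q \near x, A q /\ B q.
Proof. exact: filterI. Qed.

Lemma dnbhs_and (T : topologicalType) (x : T) (A B : T -> Prop) :
  (\forall q \near x^', A q) -> (\forall q \near x^', B q) ->
  \forall q \near x^', A q /\ B q.
Proof. exact: filterI. Qed.

(** * Derivatives of functions of one variable over a normed field *)

Section OneVariableCalculus.
Variable C : numFieldType.
Implicit Types (f g : C -> C) (s : C).

Lemma near_normP (P : C -> Prop) s : (\forall u \near s, P u) <->
  exists2 e : C, 0 < e & forall u, `|s - u| < e -> P u.
Proof.
split=> [/nbhs_ballP[e /= e0 eP]|[e e0 eP]].
  by exists e => // u su; apply: eP; rewrite -ball_normE.
by apply/nbhs_ballP; exists e => // u; rewrite -ball_normE => /eP.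
Qed.

Lemma neq_near_continuous (S : topologicalType) (f : S -> C) a w :
  {for a, continuous f} -> f a != w -> \forall u \near a, f u != w.
Proof.
move=> fc faw; apply: (continuous_near (A := fun u => u != w) fc).
apply/near_normP; exists `|f a - w|; first by rewrite normr_gt0 subr_eq0.
by move=> u; apply: contraTneq => ->; rewrite ltxx.
Qed.

Lemma is_derive_unique f s d d' : is_derive s 1 f d -> is_derive s 1 f d' -> d = d'.
Proof. by move=> [_ <-] [_ <-]. Qed.

Lemma derivable_is_derive1 f s : derivable f s 1 -> is_derive s 1 f (derive1 f s).
Proof. by move=> df; rewrite derive1E; apply: derivableP. Qed.

Lemma is_derive_derive1 f s d : is_derive s 1 f d -> derive1 f s = d.
Proof. by move=> df; rewrite derive1E derive_val. Qed.

Lemma is_derive_continuous f s d : is_derive s 1 f d -> {for s, continuous f}.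
Proof. by move=> df; apply/differentiable_continuous/derivable1_diffP/ex_derive. Qed.

Lemma is_derive1D f g s df dg : is_derive s 1 f df -> is_derive s 1 g dg ->
  is_derive s 1 (fun u => f u + g u) (df + dg).
Proof. exact: is_deriveD. Qed.

Lemma is_derive1B f g s df dg : is_derive s 1 f df -> is_derive s 1 g dg ->
  is_derive s 1 (fun u => f u - g u) (df - dg).
Proof. exact: is_deriveB. Qed.

Lemma is_derive1M f g s df dg : is_derive s 1 f df -> is_derive s 1 g dg ->
  is_derive s 1 (fun u => f u * g u) (df * g s + f s * dg).
Proof.
move=> hf hg; apply: is_derive_eq (is_deriveM hf hg) _.
by rewrite addrC [in RHS]mulrC.
Qed.

Lemma is_derive1V f s df : is_derive s 1 f df -> f s != 0 ->
  is_derive s 1 (fun u => (f u)^-1) (- df / f s ^+ 2).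
Proof.
move=> hf f0; have df' := @ex_derive _ _ _ _ _ _ _ hf.
apply: DeriveDef; first exact: derivableV.
rewrite deriveV// derive_val /GRing.scale /= mulNr mulrC.
by rewrite mulNr.
Qed.

Lemma is_derive1_cst (c s : C) : is_derive s 1 (fun=> c) 0.
Proof. exact: is_derive_cst. Qed.

Lemma is_derive1_sum (I : Type) (r : seq I) (P : pred I) (F : I -> C -> C)
    (dF : I -> C) s :
  (forall i, P i -> is_derive s 1 (F i) (dF i)) ->
  is_derive s 1 (fun u => \sum_(i <- r | P i) F i u) (\sum_(i <- r | P i) dF i).
Proof.
move=> h; elim: r => [|i r ih].
  under eq_fun do rewrite big_nil; rewrite big_nil; exact: is_derive1_cst.
under eq_fun do rewrite big_cons; rewrite big_cons.
by case: ifP => // Pi; apply: is_derive1D ih; apply: h.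
Qed.

Lemma derivable1D f g s : derivable f s 1 -> derivable g s 1 ->
  derivable (fun u => f u + g u) s 1.
Proof. exact: derivableD. Qed.

Lemma derivable1M f g s : derivable f s 1 -> derivable g s 1 ->
  derivable (fun u => f u * g u) s 1.
Proof. exact: derivableM. Qed.

Lemma derivable1V f s : f s != 0 -> derivable f s 1 ->
  derivable (fun u => (f u)^-1) s 1.
Proof. exact: derivableV. Qed.

Lemma derivable1X f d s : derivable f s 1 -> derivable (fun u => f u ^+ d) s 1.
Proof.
move=> df; elim: d => [|d ih]; first exact: derivable_cst.
by under eq_fun do rewrite exprS; exact: derivable1M.
Qed.

Lemma derivable1_sum (I : Type) (r : seq I) (F : I -> C -> C) s :
  (forall i, derivable (F i) s 1) ->
  derivable (fun u => \sum_(i <- r) F i u) s 1.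
Proof.
move=> h; apply: ex_derive; apply: is_derive1_sum => i _.
exact: derivable_is_derive1.
Qed.

Lemma derivable1_prod (I : Type) (r : seq I) (F : I -> C -> C) s :
  (forall i, derivable (F i) s 1) ->
  derivable (fun u => \prod_(i <- r) F i u) s 1.
Proof.
move=> h; elim: r => [|i r ih].
  by under eq_fun do rewrite big_nil; exact: derivable_cst.
under eq_fun do rewrite big_cons.
exact: derivableM.
Qed.

Lemma derivable1_comp f g s : derivable f s 1 -> derivable g (f s) 1 ->
  derivable (g \o f) s 1.
Proof.
move=> /derivable1_diffP df /derivable1_diffP dg.
exact/derivable1_diffP/differentiable_comp.
Qed.

Lemma is_derive1_chain f g s df dg : is_derive s 1 f df ->
  is_derive (f s) 1 g dg -> is_derive s 1 (g \o f) (dg * df).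
Proof.
move=> hf hg.
have hf' := @ex_derive _ _ _ _ _ _ _ hf.
have hg' := @ex_derive _ _ _ _ _ _ _ hg.
apply: DeriveDef; first exact: derivable1_comp.
move/derivable1_diffP: (hf') => hf2; move/derivable1_diffP: (hg') => hg2.
rewrite -derive1E derive1E'; last exact/differentiable_comp.
rewrite diff_comp //= -(is_derive_derive1 hf) -(is_derive_derive1 hg).
rewrite !derive1E' //= -[X in 'd g _ X]mulr1.
by rewrite [LHS]linearZ mulrC.
Qed.

(** This form has no quotient, so [h = 0] needs no exception. It serves as the common language for
    real and complex derivatives, which are derivatives over two different fields. *)
Lemma is_derive1P f s d : is_derive s 1 f d <->
  forall e : C, 0 < e ->
    \forall h \near 0, `|f (h + s) - f s - d * h| <= e * `|h|.
Proof.
have E h : h != 0 -> h^-1 *: (f (h *: 1 + s) - f s) - d =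
    (f (h + s) - f s - d * h) / h.
  by move=> h0; rewrite [h *: 1]mulr1 [in RHS]mulrBl mulfK// mulrC.
split=> [[df dE]|H].
- have : (fun h => h^-1 *: ((f \o shift s) (h *: 1) - f s)) @ 0^' --> d.
    by rewrite -dE; exact: df.
  move=> /cvgrPdist_le /= dl e e0; have := dl _ e0.
  rewrite near_withinE; apply: filterS => h hh.
  have [->|h0] := eqVneq h 0.
    by rewrite add0r subrr mulr0 subrr !normr0 mulr0.
  have := hh h0; rewrite distrC E// normrM normfV ler_pdivrMr//.
  by rewrite normr_gt0.
- have dl : (fun h => h^-1 *: ((f \o shift s) (h *: 1) - f s)) @ 0^' --> d.
    apply/cvgrPdist_le => /= e e0; rewrite near_withinE.
    apply: filterS (H _ e0) => h hh h0.
    by rewrite distrC E// normrM normfV ler_pdivrMr// normr_gt0.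
  apply: DeriveDef; last exact: cvg_lim dl.
  by apply/cvg_ex; exists d.
Qed.

End OneVariableCalculus.

(** * The complex exponential, branches of the logarithm, and constancy from a zero derivative *)

Section ComplexCalculus.
Variable R : realType.
Local Notation C := (Cplx R).
Local Open Scope complex_scope.
Implicit Types (w s : C) (F : C -> C).

Lemma expCD w s : expC (w + s) = expC w * expC s.
Proof.
case: w s => [a b] [c d]; rewrite /expC /=.
rewrite expRD cosD sinD [RHS]/GRing.mul /=.
by congr (_ +i* _); ring.
Qed.

Lemma expC0 : expC (0 : C) = 1.
Proof. by rewrite /expC /= expR0 cos0 sin0 mulr0 mulr1. Qed.

Lemma expC_neq0 w : expC w != 0.
Proof.
apply/eqP => e0; have := expC0; rewrite -(subrr w) expCD e0 mul0r.
by move/eqP; rewrite eq_sym oner_eq0.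
Qed.

Lemma normC_le_ReIm (a b : R) : `|(a +i* b : C)| <= (`|a| + `|b|)%:C.
Proof.
rewrite normc_def lecR /= -[leRHS]ger0_norm ?addr_ge0// -sqrtr_sqr.
rewrite ler_sqrt ?sqr_ge0// sqrrD !real_normK ?num_real//.
by rewrite addrAC lerDl mulrn_wge0// mulr_ge0.
Qed.

Lemma normC_ge_ReIm w : (`|complex.Re w|%:C <= `|w|) && (`|complex.Im w|%:C <= `|w|).
Proof.
case: w => a b; rewrite normc_def /= !lecR -!sqrtr_sqr.
by rewrite !ler_sqrt ?addr_ge0 ?sqr_ge0// lerDl lerDr !sqr_ge0.
Qed.

Lemma near0_ReIm (P : R -> Prop) : (\forall h \near (0 : R), P h) ->
  \forall h \near (0 : C), P (complex.Re (h : R[i])) /\ P (complex.Im (h : R[i])).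
Proof.
move=> /near_normP[e e0 eP]; apply/near_normP; exists e%:C; first by rewrite ltcR.
move=> h; rewrite sub0r normrN => he.
have /andP[h1 h2] := normC_ge_ReIm h.
by split; apply: eP; rewrite sub0r normrN -ltcR; apply: le_lt_trans he.
Qed.

(** The addition law reduces the claim to the origin, where real and imaginary parts are estimated
    from the real derivatives of [expR], [cos] and [sin]. *)
Lemma is_derive_expC w : is_derive w 1 (@expC R) (expC w).
Proof.
suff H : is_derive (0 : C) 1 (@expC R) 1.
  have -> : @expC R = (fun u => expC w * expC (u - w)).
    by apply/funext => u; rewrite -expCD addrC subrK.
  have dw : is_derive w 1 (fun u => u - w) (1 - 0).
    exact: (is_derive1B (is_derive_id _ _) (is_derive1_cst _ _)).
  have dE : is_derive w 1 (fun u => expC (u - w)) (1 * (1 - 0)).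
    by apply: (is_derive1_chain dw); rewrite subrr; exact: H.
  apply: is_derive_eq (is_derive1M (is_derive1_cst (expC w) w) dE) _.
  by rewrite mul0r add0r subr0 subrr expC0 !mulr1.
apply/is_derive1P => e e0.
have eR : e = (complex.Re (e : R[i]))%:C by rewrite RRe_real// gtr0_real.
move: e0; rewrite {}eR ltcR; move: (complex.Re (e : R[i])) => d d0 {e}.
have dd k : (0 < k)%N -> 0 < d / k%:R by move=> k0; rewrite divr_gt0// ltr0n.
(* The errors of cosine and sine get multiplied by [expR a], which is at most 2; hence [d / 12] for
   them and [d / 6] for the exponential and for its distance to 1. Four terms of size [d / 6]
   result, within the budget of six. *)
have hE := proj1 (is_derive1P _ _ _) (is_derive_expR (0 : R)) (d / 6%:R) (dd 6%N isT).
have hc := proj1 (is_derive1P _ _ _) (is_derive_cos (0 : R)) (d / 12%:R) (dd 12%N isT).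
have hs := proj1 (is_derive1P _ _ _) (is_derive_sin (0 : R)) (d / 12%:R) (dd 12%N isT).
have hx : \forall h \near (0 : R), `|expR h - 1| <= Num.min 1 (d / 6%:R).
  have m0 : 0 < Num.min 1 (d / 6%:R) by rewrite lt_min ltr01 dd.
  have /cvgrPdist_le /(_ _ m0) := @continuous_expR R 0.
  by apply: filterS => h; rewrite expR0 distrC.
move: hE hc hs hx => /near0_ReIm hE /near0_ReIm hc /near0_ReIm hs /near0_ReIm hx.
apply: filterS (filterI (filterI hE hc) (filterI hs hx)) => -[a b] /=.
move=> [[[Ea _] [_ cb]] [[_ sb] [xa _]]].
move: Ea cb sb xa; rewrite !addr0 expR0 cos0 sin0 oppr0 !mul0r !mul1r !subr0.
rewrite le_min => Ea cb sb /andP[x1 x2].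
rewrite addr0 in sb; rewrite expC0.
have -> : expC (a +i* b : C) - 1 - (a +i* b) =
  ((expR a * cos b - 1 - a) +i* (expR a * sin b - b)) :> C.
  by rewrite /expC /= [LHS]/GRing.add /= !subr0.
apply: le_trans (normC_le_ReIm _ _) _.
have x3 : `|expR a| <= 2.
  rewrite -[expR a](subrK 1); apply: le_trans (ler_normD _ _) _.
  by rewrite normr1; lra.
have b1 : `|expR a * cos b - 1 - a| <= d / 6%:R * `|b| + d / 6%:R * `|a|.
  have -> : expR a * cos b - 1 - a = expR a * (cos b - 1) + (expR a - 1 - a) by ring.
  apply: le_trans (ler_normD _ _) _; apply: lerD => //.
  rewrite normrM; apply: le_trans (ler_pM _ _ x3 cb) _ => //.
  by rewrite le_eqVlt; apply/orP; left; apply/eqP; field.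
have b2 : `|expR a * sin b - b| <= d / 6%:R * `|b| + d / 6%:R * `|b|.
  have -> : expR a * sin b - b = expR a * (sin b - b) + (expR a - 1) * b by ring.
  apply: le_trans (ler_normD _ _) _; rewrite !normrM; apply: lerD => //.
    apply: le_trans (ler_pM _ _ x3 sb) _ => //.
    by rewrite le_eqVlt; apply/orP; left; apply/eqP; field.
  by rewrite ler_wpM2r.
have /andP[/= n1 n2] := normC_ge_ReIm (a +i* b).
have : (`|expR a * cos b - 1 - a| + `|expR a * sin b - b|)%:C <=
   (d / 6%:R)%:C * (`|a|%:C + `|b|%:C + `|b|%:C + `|b|%:C) :> C.
  by rewrite -!rmorphD -rmorphM lecR; apply: le_trans (lerD b1 b2) _; lra.
move/le_trans; apply.
have -> : d%:C * `|a +i* b| = (d / 6%:R)%:C *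
     (`|a +i* b| + `|a +i* b| + `|a +i* b| + `|a +i* b| + (`|a +i* b| + `|a +i* b|)) :> C.
  have -> : d%:C = (d / 6%:R)%:C * 6%:R :> C.
    by rewrite -(rmorph_nat (real_complex R)) -rmorphM /= divfK// pnatr_eq0.
  by ring.
apply: ler_wpM2l; first by rewrite ler0c ltW ?dd.
by rewrite -[leLHS]addr0; do !apply: lerD => //; apply: addr_ge0.
Qed.

(** Differentiate [expC (L u) = u] by the chain rule. *)
Lemma ln_is_derive (L : C -> C) w : derivable L w 1 ->
  (\forall u \near w, expC (L u) = u) -> is_derive w 1 L w^-1.
Proof.
move=> dL eL; have dL1 := derivable_is_derive1 dL.
have := is_derive1_chain dL1 (is_derive_expC (L w)).
move=> /(near_eq_is_derive eL) /is_derive_unique /(_ (is_derive_id _ _)).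
rewrite (nbhs_singleton eL) => E; apply: is_derive_eq dL1 _.
have w0 : w != 0 by rewrite -(nbhs_singleton eL) expC_neq0.
by apply: (mulfI w0); rewrite E mulfV.
Qed.

Lemma is_derive_Re_path F (t : R) : is_derive (t%:C : C) 1 F 0 ->
  is_derive t 1 (fun r : R => complex.Re (F r%:C : R[i])) 0 /\
  is_derive t 1 (fun r : R => complex.Im (F r%:C : R[i])) 0.
Proof.
move=> /is_derive1P dF.
have H e : 0 < e -> \forall h \near (0:R),
    `|F (h + t)%:C - F t%:C| <= e%:C * `|h|%:C.
  move=> e0; have := dF e%:C; rewrite ltcR => /(_ e0).
  move=> /near_normP[r r0 rP].
  apply/near_normP; exists (complex.Re (r : R[i])).
    by rewrite -ltcR RRe_real// gtr0_real.
  have nE (h : R) : `|h%:C| = `|h|%:C :> C.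
    by rewrite normc_def /= expr0n /= addr0 sqrtr_sqr.
  move=> h; rewrite sub0r normrN => hr.
  have := rP h%:C; rewrite sub0r normrN mul0r subr0 -rmorphD /= nE.
  by apply; rewrite -(RRe_real (gtr0_real r0)) ltcR.
split; apply/is_derive1P => e /H; apply: filterS => h.
all: have /andP[n1 n2] := normC_ge_ReIm (F (h + t)%:C - F t%:C).
- move/(le_trans n1); rewrite -rmorphM lecR mul0r subr0.
  by case: (F _) (F t%:C) => ? ? [].
- move/(le_trans n2); rewrite -rmorphM lecR mul0r subr0.
  by case: (F _) (F t%:C) => ? ? [].
Qed.

(** The mean value theorem fails for complex values, so it is applied to the real and imaginary
    parts, as functions of a real parameter. *)
Lemma segment_constant F :
  (forall t : R, 0 <= t <= 1 -> is_derive (t%:C : C) 1 F 0) -> F 1 = F 0.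
Proof.
move=> dF.
have key (f : R -> R) : (forall t : R, 0 <= t <= 1 -> is_derive t 1 f 0) -> f 1 = f 0.
  move=> df; have [|||c _] := @MVT_segment R f (fun=> 0) 0 1 => //.
  - by move=> x; rewrite in_itv /= => /andP[x0 x1]; apply: df; rewrite !ltW.
  - apply: derivable_within_continuous => x; rewrite in_itv /= => /df [] //.
  - by rewrite mul0r => /eqP; rewrite subr_eq0 => /eqP.
have /key eR : forall t : R, 0 <= t <= 1 ->
    is_derive t 1 (fun r : R => complex.Re (F r%:C : R[i])) 0.
  by move=> t /dF /is_derive_Re_path[].
have /key eI : forall t : R, 0 <= t <= 1 ->
    is_derive t 1 (fun r : R => complex.Im (F r%:C : R[i])) 0.
  by move=> t /dF /is_derive_Re_path[].
have e1 : 1%:C = 1 :> C by [].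
have e0 : 0%:C = 0 :> C by [].
by move: eR eI; rewrite e1 e0; case: (F 1) (F 0) => ? ? [? ?] /= -> ->.
Qed.

Lemma ball_constant F (s r : C) : 0 < r ->
  (forall u, `|s - u| < r -> is_derive u 1 F 0) ->
  forall u, `|s - u| < r -> F u = F s.
Proof.
move=> r0 dF u su.
pose G v := F (s + v * (u - s)).
have -> : F u = G 1 by rewrite /G mul1r addrC subrK.
have -> : F s = G 0 by rewrite /G mul0r addr0.
apply: segment_constant => t /andP[t0 t1].
have dl : is_derive (t%:C : C) 1 (fun v => s + v * (u - s)) (u - s).
  apply: is_derive_eq (is_derive1D (is_derive1_cst _ _)
    (is_derive1M (is_derive_id _ _) (is_derive1_cst _ _))) _.
  by ring.
rewrite -[X in is_derive _ _ _ X](mul0r (u - s)).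
apply: (is_derive1_chain dl); apply: dF.
rewrite opprD addNKr normrN normrM; apply: le_lt_trans su.
rewrite -[leRHS]mul1r distrC ler_wpM2r// normc_def /= expr0n /= addr0 sqrtr_sqr.
by rewrite ger0_norm// (lecR _ 1).
Qed.

End ComplexCalculus.

(** * Neighbourhoods in charts and meromorphic functions near a point *)

Section SurfaceTopology.
Variables (R : realType) (U : riemannSurface R).
Local Notation C := (Cplx R).
Implicit Types (p q : U) (c : chart R U) (P : U -> Prop) (h : U -> C) (f : merofun U).

Lemma chart_map_near c p : chart_dom c p ->
  \forall s \near chart_map c p, chart_dom c (chart_inv c s) /\
    chart_map c (chart_inv c s) = s.
Proof.
move=> cp; have : nbhs (chart_map c p) (chart_map c @` chart_dom c).
  by apply: open_nbhs_nbhs; split; [exact: chart_img_open|exists p].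
by apply: filterS => s [q cq <-]; rewrite chart_mapK.
Qed.

Lemma chart_inv_near c p P : chart_dom c p -> (\forall q \near p, P q) ->
  \forall s \near chart_map c p, P (chart_inv c s).
Proof. by move=> cp Pp; apply: (chart_inv_cont cp); rewrite chart_mapK. Qed.

Lemma chart_dom_near c p : chart_dom c p -> \forall q \near p, chart_dom c q.
Proof.
move=> cp; suff : nbhs p (chart_dom c) by [].
by apply: open_nbhs_nbhs; split => //; exact: chart_dom_open.
Qed.

Lemma near_chart_inv c p P : chart_dom c p ->
  (\forall s \near chart_map c p, P (chart_inv c s)) -> \forall q \near p, P q.
Proof.
move=> cp /(chart_map_cont cp) Pp.
have {}Pp : \forall q \near p, P (chart_inv c (chart_map c q)) by [].
by apply: filterS2 Pp (chart_dom_near cp) => q Pq cq; rewrite chart_mapK in Pq.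
Qed.

(** The surface has no isolated points, because a chart carries a neighbourhood of p onto one of a
    point of the complex plane. This is how generic points near [p0] are chosen. *)
Lemma dnbhs_nonempty p P : (\forall q \near p^', P q) -> exists q, P q.
Proof.
rewrite near_withinE => Pp; have [c ca cp] := rs_cover p.
have H := near_and (chart_inv_near cp Pp) (chart_map_near cp).
have /filter_ex[s [[H1 [H2 H3]] sN]] :
    \forall s \near (chart_map c p)^', ((chart_inv c s != p -> P (chart_inv c s)) /\
    chart_dom c (chart_inv c s) /\ chart_map c (chart_inv c s) = s) /\
    s != chart_map c p.
  by rewrite near_withinE; apply: filterS H => s Hs sp.
exists (chart_inv c s); apply: H1; apply: contra_neq sN => <-.
by rewrite H3.
Qed.

Lemma neq_near p q : p != q -> \forall r \near p, r != q.
Proof.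
move=> pq; suff : nbhs p (~` [set q]) by apply: filterS => r /eqP.
apply: open_nbhs_nbhs; split; last exact/eqP.
by apply: closed_openC; apply: accessible_closed_set1; apply: hausdorff_accessible;
  exact: rs_hausdorff.
Qed.

(** Points are closed, so a property on a punctured neighbourhood of p holds on a full neighbourhood
    of each nearby [q != p]. Differentiating an identity at q needs this stronger form. *)
Lemma dnbhs_near p P : (\forall q \near p^', P q) ->
  \forall q \near p^', q != p /\ \forall r \near q, P r.
Proof.
rewrite !near_withinE => H; have {}H := nbhs_interior H.
apply: filterS H => q Hq qp; split=> //.
by apply: filterS2 Hq (neq_near qp) => r.
Qed.

Lemma near_dnbhs p P : (\forall q \near p, P q) -> \forall q \near p^', P q.
Proof. by move=> Pp; rewrite near_withinE; apply: filterS Pp. Qed.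

Lemma cdiff_at_is_derive h p c : cdiff_at h p -> rs_atlas c -> chart_dom c p ->
  is_derive (chart_map c p) 1 (h \o chart_inv c)
    (derive1 (h \o chart_inv c) (chart_map c p)).
Proof. by move=> hp ca cp; apply: derivable_is_derive1; apply: hp. Qed.

Lemma cdiff_at_continuous h p : cdiff_at h p -> {for p, continuous h}.
Proof.
move=> hp; have [c ca cp] := rs_cover p.
have hc := is_derive_continuous (cdiff_at_is_derive hp ca cp).
move=> A Ap; suff : \forall q \near p, A (h q) by [].
apply: (near_chart_inv (P := fun q => A (h q)) cp); apply: hc.
by rewrite /= chart_mapK.
Qed.

Lemma meromorphic_regular f p : meromorphic f -> \forall q \near p^', regular_at f q.
Proof.
move=> /(_ p)[f1 f2]; have [/f1 H|/f2[] //] := pselect (regular_at f p).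
by apply: near_dnbhs; apply: filterS H => q [].
Qed.

Lemma meromorphic_cdiff f p : meromorphic f -> regular_at f p -> cdiff_at (mval f) p.
Proof. by move=> /(_ p)[f1 _] /f1 /nbhs_singleton[]. Qed.

Lemma meromorphic_near f p : meromorphic f -> regular_at f p ->
  \forall q \near p, regular_at f q.
Proof. by move=> /(_ p)[f1 _] /f1; apply: filterS => q []. Qed.

Lemma regular_mval f p : regular_at f p -> f p = Some (mval f p).
Proof. by rewrite /regular_at /mval; case: (f p). Qed.

Lemma regular_Some f p u : f p = Some u -> regular_at f p.
Proof. by rewrite /regular_at => ->. Qed.

Lemma mval_Some f p u : f p = Some u -> mval f p = u.
Proof. by rewrite /mval => ->. Qed.

(** In the encoding [None] occurs exactly at poles, where the modulus eventually exceeds every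
    [M]. *)
Lemma bounded_regular f p (M : R) : meromorphic f ->
  (\forall q \near p^', `|mval f q| <= M%:C%C) -> regular_at f p.
Proof.
move=> fm fM; apply: contrapT => /(proj2 (fm p)) [_ /(_ M) fN].
have [q []] := dnbhs_nonempty (dnbhs_and fM fN).
by move=> /le_lt_trans h /h; rewrite ltxx.
Qed.

Lemma dnbhs_cst_cont h p w : {for p, continuous h} ->
  (\forall q \near p^', h q = w) -> h p = w.
Proof.
move=> hc hw; apply: contrapT => /eqP hpw.
have := neq_near_continuous hc hpw.
move=> /near_dnbhs H; have [q [/eqP]] := dnbhs_nonempty (dnbhs_and hw H).
by move=> ->.
Qed.

End SurfaceTopology.

(** * The identity theorem inside a field of meromorphic functions, and finite sums and products *)

Section IdentityTheorem.
Variables (R : realType) (U : riemannSurface R).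
Hypothesis U_connected : connected [set: U].
Local Notation C := (Cplx R).
Implicit Types (p q : U) (f g t : merofun U) (L : set (merofun U)).

(** Such a function is bounded, hence regular. By continuity it takes only the values 0 and 1
    everywhere, so it is locally constant, and connectedness concludes. *)
Lemma meromorphic_01_constant t p1 : meromorphic t ->
  (forall p, \forall q \near p^', t q = Some 0 \/ t q = Some 1) ->
  t p1 = Some 0 -> forall p, t p = Some 0.
Proof.
move=> tm t01 tp1.
have treg p : regular_at t p.
  apply: (@bounded_regular _ _ _ _ 1) => //; apply: filterS (t01 p) => q.
  by case=> /mval_Some ->; rewrite ?normr0 ?normr1 ?ler01.
have tcont p : {for p, continuous (mval t)}.
  by apply: cdiff_at_continuous; exact: meromorphic_cdiff.
have tval p : mval t p = 0 \/ mval t p = 1.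
  have : mval t p * (mval t p - 1) = 0.
    apply: (@dnbhs_cst_cont _ _ (fun q => mval t q * (mval t q - 1))).
      apply: cvgM; first exact: tcont.
      by apply: cvgB; [exact: tcont|exact: cvg_cst].
    apply: filterS (t01 p) => q.
    by case=> /mval_Some ->; rewrite ?mul0r ?subrr ?mulr0.
  move/eqP; rewrite mulf_eq0 subr_eq0 => /orP[] /eqP ->; first by left.
  by right.
have tloc p : \forall q \near p, mval t q = mval t p.
  have H : \forall u \near mval t p, `|mval t p - u| < 1.
    by apply/near_normP; exists 1.
  have {}H : \forall q \near p, `|mval t p - mval t q| < 1 := tcont p _ H.
  apply: filterS H => q.
  by case: (tval p) => ->; case: (tval q) => ->; rewrite ?subr0 ?sub0r ?normrN ?normr1 ?ltxx.
have op (w : C) : open [set p | mval t p = w].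
  by rewrite openE => p /= <-; exact: tloc.
have E : [set p | mval t p = 0] = setT.
  apply: U_connected; first by exists p1; exact: mval_Some.
    by exists [set p | mval t p = 0]; rewrite ?setTI.
  exists [set p | mval t p = 0]; rewrite ?setTI//.
  rewrite (_ : [set p | mval t p = 0] = ~` [set p | mval t p = 1]).
    by apply: open_closedC; exact: op.
  apply/seteqP; split => p /=; first by move=> ->; apply/eqP; rewrite eq_sym oner_eq0.
  by case: (tval p).
move=> p; rewrite (regular_mval (treg p)).
have : [set p | mval t p = 0] p by rewrite E.
by move=> /= ->.
Qed.

Lemma field_identity L f p : mero_subfield L -> L f ->
  (\forall q \near p^', f q = Some 0) -> f = mfin (cst 0).
Proof.
move=> LF Lf f0; apply: contrapT => fN0.
have [s Ls sP] := msf_inv LF Lf fN0.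
have [t Lt tP] := msf_mul LF Lf Ls.
(* The inverse [s] is prescribed only where f is nonzero; at a zero of f where [s] is finite the
   product [t] is 0 whatever the value of [s]. *)
have fm := msf_mero LF Lf; have sm := msf_mero LF Ls.
have t01 q v w: f q = Some v -> s q = Some w ->
    t q = Some (if v == 0 then 0 else 1).
  move=> fq sq; rewrite (tP _ _ _ fq sq); case: eqVneq => [->|v0].
    by rewrite mul0r.
  by move: sq; rewrite (sP _ _ fq v0) => -[<-]; rewrite mulfV.
have tall q : t q = Some 0.
  have [p1 [fp1 sp1]] := dnbhs_nonempty (dnbhs_and f0 (meromorphic_regular p sm)).
  have := t01 _ _ _ fp1 (regular_mval sp1); rewrite eqxx => tp1.
  apply: (meromorphic_01_constant (msf_mero LF Lt) _ tp1) => r.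
  apply: filterS (dnbhs_and (meromorphic_regular r fm) (meromorphic_regular r sm)).
  move=> r' [/regular_mval fr /regular_mval sr].
  by rewrite (t01 _ _ _ fr sr); case: ifP; [left|right].
apply: fN0; apply/funext => q.
have fq0 r : regular_at f r -> regular_at s r -> f r = Some 0.
  move=> /regular_mval fr /regular_mval sr.
  have := t01 _ _ _ fr sr; rewrite tall; case: eqVneq => [v0 _|_ []/eqP].
    by rewrite fr v0.
  by rewrite eq_sym oner_eq0.
have fnear : \forall r \near q^', f r = Some 0.
  apply: filterS (dnbhs_and (meromorphic_regular q fm) (meromorphic_regular q sm)).
  by move=> r [h1 h2]; exact: fq0.
(* A pole of f at q is excluded because f vanishes around q. *)
have fqr : regular_at f q.
  apply: (@bounded_regular _ _ _ _ 0) => //.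
  by apply: filterS fnear => r /mval_Some ->; rewrite normr0.
rewrite (regular_mval fqr); congr Some.
apply: dnbhs_cst_cont; first by apply: cdiff_at_continuous; exact: meromorphic_cdiff.
by apply: filterS fnear => r /mval_Some.
Qed.

Lemma field_sum L (I : Type) (r : seq I) (P : pred I) (F : I -> merofun U) :
  mero_subfield L -> (forall i, P i -> L (F i)) ->
  exists2 s, L s & forall p (u : I -> C),
    (forall i, P i -> F i p = Some (u i)) -> s p = Some (\sum_(i <- r | P i) u i).
Proof.
(* The subfield axioms provide only the constant 1, so the empty sum is built as [1 + (-1)]. *)
move=> LF LFi; have [z Lz zP] : exists2 z, L z & forall p, z p = Some 0.
  have [m Lm mP] := msf_opp LF (msf_one LF).
  have [z Lz zP] := msf_add LF (msf_one LF) Lm.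
  exists z => // p; rewrite (zP p 1 (-1)) ?subrr//.
  by rewrite (mP p 1).
elim: r => [|i r [s Ls sP]].
  by exists z => // p u _; rewrite big_nil zP.
case: (boolP (P i)) => Pi; last first.
  by exists s => // p u pu; rewrite big_cons (negbTE Pi); exact: sP.
have [s' Ls' s'P] := msf_add LF (LFi _ Pi) Ls.
exists s' => // p u pu; rewrite big_cons Pi.
by apply: s'P; [exact: pu|exact: sP].
Qed.

Lemma field_prod L (I : Type) (r : seq I) (F : I -> merofun U) :
  mero_subfield L -> (forall i, L (F i)) ->
  exists2 s, L s & forall p (u : I -> C),
    (forall i, F i p = Some (u i)) -> s p = Some (\prod_(i <- r) u i).
Proof.
move=> LF LFi; elim: r => [|i r [s Ls sP]].
  by exists (mfin (cst 1)); [exact: msf_one|move=> p u _; rewrite big_nil].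
have [s' Ls' s'P] := msf_mul LF (LFi i) Ls.
exists s' => // p u pu; rewrite big_cons.
by apply: s'P; [exact: pu|exact: sP].
Qed.

End IdentityTheorem.

(** * Germs of rational functions over K, and their derivatives along curves *)

Section FractionGerms.
Variables (R : realType) (U : riemannSurface R).
Local Notation C := (Cplx R).
Variables (T : finType) (p0 : U) (v0 : T -> C).
Local Notation fiberfun := (U -> (T -> C) -> C).
Implicit Types (p q : U) (v : T -> C) (A B : U -> (T -> C) -> Prop) (G H : fiberfun).

(* Fibers are handled as functions [T -> C]; only the passage to the matrices of
   [coord_space], in [near_fiberP], uses their topology. *)
Definition fiber_near (F : set_system U) v A := exists2 e : C, 0 < e &
  \forall p \near F, forall v', (forall t, `|v t - v' t| < e) -> A p v'.

(** Punctured in the base, where coefficients may have a pole at [p0], but not in the fiber. The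
    radius is chosen before the base point, so segments from [v0] inside the ball are available over
    every p near [p0]. *)
Definition pnear A := fiber_near p0^' v0 A.

Definition lnear A p v := fiber_near (nbhs p) v A.

Lemma fiber_near_and F v A B : Filter F -> fiber_near F v A -> fiber_near F v B ->
  fiber_near F v (fun p v' => A p v' /\ B p v').
Proof.
move=> FF [e e0 hA] [d d0 hB].
(* The order of the complex numbers is partial; radii are comparable because positive elements are
   real. *)
have cmp : (e >=< d)%R by apply: real_comparable; exact: gtr0_real.
exists (Num.min e d); first by rewrite comparable_lt_min// e0.
apply: filterS2 hA hB => p Ap Bp v' vP.
by split; [apply: Ap|apply: Bp] => t; have := vP t; rewrite comparable_lt_min// => /andP[].
Qed.

Lemma fiber_nearS F v A B : Filter F -> (forall p v', A p v' -> B p v') ->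
  fiber_near F v A -> fiber_near F v B.
Proof.
by move=> FF AB [e e0 hA]; exists e => //; apply: filterS hA => p Ap v' /Ap; exact: AB.
Qed.

Lemma fiber_near_forall (I : finType) F v (D : I -> U -> (T -> C) -> Prop) : Filter F ->
  (forall i, fiber_near F v (D i)) -> fiber_near F v (fun p v' => forall i, D i p v').
Proof.
move=> FF H; suff : fiber_near F v (fun p v' => forall i, i \in enum I -> D i p v').
  by apply: fiber_nearS => p v' h i; apply: h; rewrite mem_enum.
elim: (enum I) => [|i r ih]; first by exists 1 => //; apply: nearW.
apply: fiber_nearS (fiber_near_and _ (H i) ih) => p v' [Di Dr] j.
by rewrite in_cons => /orP[/eqP ->|/Dr].
Qed.

Lemma pnear_and A B : pnear A -> pnear B -> pnear (fun p v => A p v /\ B p v).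
Proof. exact: fiber_near_and. Qed.

Lemma lnear_and A B p v : lnear A p v -> lnear B p v ->
  lnear (fun q v' => A q v' /\ B q v') p v.
Proof. exact: fiber_near_and. Qed.

Lemma pnearS A B : (forall p v, A p v -> B p v) -> pnear A -> pnear B.
Proof. exact: fiber_nearS. Qed.

Lemma lnearS A B p v : (forall q v', A q v' -> B q v') -> lnear A p v -> lnear B p v.
Proof. exact: fiber_nearS. Qed.

Lemma pnear_forall (I : finType) (D : I -> U -> (T -> C) -> Prop) :
  (forall i, pnear (D i)) -> pnear (fun p v => forall i, D i p v).
Proof. exact: fiber_near_forall. Qed.

Lemma lnear_forall (I : finType) (D : I -> U -> (T -> C) -> Prop) p v :
  (forall i, lnear (D i) p v) -> lnear (fun q v' => forall i, D i q v') p v.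
Proof. exact: fiber_near_forall. Qed.

Lemma pnear_base (P : U -> Prop) : (\forall p \near p0^', P p) -> pnear (fun p _ => P p).
Proof. by move=> Pp; exists 1 => //; apply: filterS Pp. Qed.

Lemma pnear_all A : (forall p v, A p v) -> pnear A.
Proof. by move=> AA; exists 1 => //; apply: nearW => p v _; exact: AA. Qed.

Lemma lnear_self A p v : lnear A p v -> lnear (lnear A) p v.
Proof.
move=> [e e0 hA]; exists (e / 2); first by rewrite divr_gt0.
have := nbhs_interior hA; apply: filterS => q Aq v' v'P.
exists (e / 2); first by rewrite divr_gt0.
apply: filterS Aq => q' Aq v'' v''P; apply: Aq => t.
rewrite -[v t](subrK (v' t)) -addrA [e]splitr.
by apply: le_lt_trans (ler_normD _ _) _; apply: ltrD.
Qed.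

Lemma pnear_lnear A : pnear A -> pnear (lnear A).
Proof.
move=> [e e0 hA]; exists (e / 2); first by rewrite divr_gt0.
have := dnbhs_near hA; apply: filterS => p [_ Ap] v vP.
exists (e / 2); first by rewrite divr_gt0.
apply: filterS Ap => q Aq v' v'P; apply: Aq => t.
rewrite -[v0 t](subrK (v t)) -addrA [e]splitr.
by apply: le_lt_trans (ler_normD _ _) _; apply: ltrD.
Qed.

Lemma lnear_curve A p v (b : C -> U) (V : C -> T -> C) s :
  lnear A p v -> b s = p -> V s = v -> {for s, continuous b} ->
  (forall t, {for s, continuous (V^~ t)}) -> \forall u \near s, A (b u) (V u).
Proof.
move=> [e e0 hA] bs Vs bc Vc.
have h1 : \forall u \near s, forall v', (forall t, `|v t - v' t| < e) -> A (b u) v'.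
  by apply: (continuous_near (A := fun q => forall v', _ -> A q v') bc); rewrite bs.
have h2 : \forall u \near s, forall t, `|v t - V u t| < e.
  apply: near_all => t.
  have h : \forall w \near V s t, `|v t - w| < e by rewrite Vs; apply/near_normP; exists e.
  exact: continuous_near (Vc t) h.
by apply: filterS (near_and h1 h2) => u [h /h].
Qed.

Lemma near_section (e : C) v (g : T -> U -> C) p : 0 < e ->
  (forall t, {for p, continuous (g t)}) -> (forall t, g t p = v t) ->
  \forall q \near p, forall t, `|v t - g t q| < e.
Proof.
move=> e0 gc gp; apply: near_all => t.
have h : \forall w \near g t p, `|v t - w| < e by rewrite gp; apply/near_normP; exists e.
exact: continuous_near (gc t) h.
Qed.

Lemma pnear_section A (g : T -> U -> C) : pnear A ->
  (forall t, {for p0, continuous (g t)}) -> (forall t, g t p0 = v0 t) ->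
  \forall p \near p0^', A p (g^~ p).
Proof.
move=> [e e0 hA] gc g0.
by apply: filterS (dnbhs_and hA (near_dnbhs (near_section e0 gc g0))) => p [h /h].
Qed.

Lemma lnear_section A (g : T -> U -> C) p v : lnear A p v ->
  (forall t, {for p, continuous (g t)}) -> (forall t, g t p = v t) ->
  \forall q \near p, A q (g^~ q).
Proof.
move=> [e e0 hA] gc gp.
by apply: filterS (near_and hA (near_section e0 gc gp)) => q [h /h].
Qed.

Lemma lnear_pnear A : lnear A p0 v0 -> pnear A.
Proof. by move=> [e e0 hA]; exists e => //; exact: near_dnbhs. Qed.

(** Joint holomorphy, tested along curves; the condition on [h] says that the base curve [b] is
    holomorphic at s. It gives no formula for the derivative, so that it can hold over [p0] itself,
    where the partial derivatives may have poles. *)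
Definition curve_derivable G p v :=
  forall (b : C -> U) (s : C) (V : C -> T -> C), b s = p -> V s = v ->
    {for s, continuous b} -> (forall h, cdiff_at h p -> derivable (h \o b) s 1) ->
    (forall t, derivable (V^~ t) s 1) -> derivable (fun u => G (b u) (V u)) s 1.

Lemma curve_derivable_ext G H p v :
  lnear (fun q v' => G q v' = H q v') p v -> curve_derivable G p v -> curve_derivable H p v.
Proof.
move=> GH dG b s V bs Vs bc hb hV.
apply: near_eq_derivable (dG b s V bs Vs bc hb hV).
have Vc t : {for s, continuous (V^~ t)}.
  exact: is_derive_continuous (derivable_is_derive1 (hV t)).
exact: (lnear_curve GH bs Vs bc Vc).
Qed.

Variables (x : merofun U) (K : set (merofun U)).

(** Germs of elements of K(y, z), generated by field operations, so that differentiation, clearing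
    denominators and evaluation along a section are all inductions. Inversion asks for a germ
    without zeros on a [pnear] set. *)
Inductive rat_germ : fiberfun -> Prop :=
| rat_germ_coef f : K f -> rat_germ (fun p _ => mval f p)
| rat_germ_crd t : rat_germ (fun _ v => v t)
| rat_germ_add G H : rat_germ G -> rat_germ H -> rat_germ (fun p v => G p v + H p v)
| rat_germ_mul G H : rat_germ G -> rat_germ H -> rat_germ (fun p v => G p v * H p v)
| rat_germ_inv G : rat_germ G -> pnear (fun p v => G p v != 0) -> rat_germ (fun p v => (G p v)^-1)
| rat_germ_ext G H : rat_germ G -> pnear (fun p v => G p v = H p v) -> rat_germ H.

(* Covers both inverse charts ([r] is the derivative of x in the chart) and constant
   curves ([r = 0]), so that one chain rule gives all the partial derivatives. *)
Definition base_curve (b : C -> U) (s r : C) := {for s, continuous b} /\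
  forall f g, K f -> K g -> (forall p, deriv_at x f g p) ->
    regular_at x (b s) -> regular_at f (b s) -> regular_at g (b s) ->
    is_derive s 1 (fun u => mval f (b u)) (mval g (b s) * r).

(** The chain rule as a definition of the partial derivatives: [G0] is the derivative in x at fixed
    fiber coordinates, [r] is the derivative of x along the curve, and [Gt t] is the partial
    derivative in the coordinate [t]. *)
Definition diff_along G G0 (Gt : T -> fiberfun) p v :=
  forall (b : C -> U) (s r : C) (V : C -> T -> C) (dV : T -> C),
    b s = p -> V s = v -> base_curve b s r ->
    (forall t, is_derive s 1 (V^~ t) (dV t)) ->
    is_derive s 1 (fun u => G (b u) (V u)) (G0 p v * r + \sum_t Gt t p v * dV t).

Definition tdiff G G0 (Gt : T -> fiberfun) := pnear (diff_along G G0 Gt).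

Definition rat_germ_diff G := exists G0 Gt,
  [/\ rat_germ G0, forall t, rat_germ (Gt t) & tdiff G G0 Gt].

Hypothesis K_fdf : functional_differential_field x K.
Hypothesis x_mero : meromorphic x.

Lemma rat_germ_cst (w : C) : rat_germ (fun _ _ => w).
Proof. exact: (rat_germ_coef (fdf_const K_fdf w)). Qed.

Lemma rat_germ_opp G : rat_germ G -> rat_germ (fun p v => - G p v).
Proof.
move=> fG; apply: (rat_germ_ext (rat_germ_mul (rat_germ_cst (-1)) fG)).
by apply: pnear_all => p v; rewrite mulN1r.
Qed.

Lemma rat_germ_sub G H : rat_germ G -> rat_germ H -> rat_germ (fun p v => G p v - H p v).
Proof. by move=> fG fH; apply: rat_germ_add fG (rat_germ_opp fH). Qed.

Lemma rat_germ_sum (I : Type) (r : seq I) (F : I -> fiberfun) :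
  (forall i, rat_germ (F i)) -> rat_germ (fun p v => \sum_(i <- r) F i p v).
Proof.
move=> fF; elim: r => [|i r ih].
  under eq_fun do under eq_fun do rewrite big_nil; exact: rat_germ_cst.
by under eq_fun do under eq_fun do rewrite big_cons; exact: rat_germ_add.
Qed.

Lemma rat_germ_prod (I : Type) (r : seq I) (F : I -> fiberfun) :
  (forall i, rat_germ (F i)) -> rat_germ (fun p v => \prod_(i <- r) F i p v).
Proof.
move=> fF; elim: r => [|i r ih].
  under eq_fun do under eq_fun do rewrite big_nil; exact: rat_germ_cst.
by under eq_fun do under eq_fun do rewrite big_cons; exact: rat_germ_mul.
Qed.

Lemma rat_germ_exp G d : rat_germ G -> rat_germ (fun p v => G p v ^+ d).
Proof.
move=> fG; elim: d => [|d ih]; first exact: rat_germ_cst.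
by under eq_fun do under eq_fun do rewrite exprS; exact: rat_germ_mul.
Qed.

(** Each constructor carries its differentiation rule, and the rules use only field operations; a
    coefficient uses the closure of K under the derivation. *)
Lemma rat_germ_diffP G : rat_germ G -> rat_germ_diff G.
Proof.
elim=> {G}.
- move=> f Kf; have [g Kg fg] := fdf_deriv K_fdf Kf.
  exists (fun p _ => mval g p), (fun _ _ _ => 0); split.
  + exact: rat_germ_coef.
  + by move=> t; exact: rat_germ_cst.
  + have fm := msf_mero (fdf_subfield K_fdf) Kf.
    have gm := msf_mero (fdf_subfield K_fdf) Kg.
    have := dnbhs_and (meromorphic_regular p0 x_mero)
      (dnbhs_and (meromorphic_regular p0 fm) (meromorphic_regular p0 gm)).
    move=> /pnear_base; apply: pnearS => p v [xr [fr gr]] b s r V dV bs Vs bc _.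
    rewrite big1 ?addr0 => [|i _]; last by rewrite mul0r.
    by rewrite -bs; apply: (proj2 bc) => //; rewrite bs.
- move=> t; exists (fun _ _ => 0), (fun t' _ _ => (t' == t)%:R); split.
  + exact: rat_germ_cst.
  + by move=> t'; exact: rat_germ_cst.
  + apply: pnear_all => p v b s r V dV _ _ _ dVP.
    rewrite mul0r add0r (bigD1 t)//= eqxx mul1r big1 ?addr0//.
    by move=> i /negbTE ->; rewrite mul0r.
- move=> G H _ [G0 [Gt [fG0 fGt tG]]] _ [H0 [Ht [fH0 fHt tH]]].
  exists (fun p v => G0 p v + H0 p v), (fun t p v => Gt t p v + Ht t p v); split.
  + exact: rat_germ_add.
  + by move=> t; exact: rat_germ_add.
  + have := pnear_and tG tH; apply: pnearS => p v [dG dH] b s r V dV bs Vs bc dVP.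
    apply: is_derive_eq (is_derive1D (dG _ _ _ _ _ bs Vs bc dVP) (dH _ _ _ _ _ bs Vs bc dVP)) _.
    by rewrite addrACA -mulrDl -big_split /=; under eq_bigr do rewrite -mulrDl.
- move=> G H fG [G0 [Gt [fG0 fGt tG]]] fH [H0 [Ht [fH0 fHt tH]]].
  exists (fun p v => G0 p v * H p v + G p v * H0 p v),
    (fun t p v => Gt t p v * H p v + G p v * Ht t p v); split.
  + by apply: rat_germ_add; apply: rat_germ_mul.
  + by move=> t; apply: rat_germ_add; apply: rat_germ_mul.
  + have := pnear_and tG tH; apply: pnearS => p v [dG dH] b s r V dV bs Vs bc dVP.
    apply: is_derive_eq (is_derive1M (dG _ _ _ _ _ bs Vs bc dVP) (dH _ _ _ _ _ bs Vs bc dVP)) _.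
    rewrite bs Vs [in RHS](eq_bigr (fun t =>
      H p v * (Gt t p v * dV t) + G p v * (Ht t p v * dV t))).
      by rewrite big_split /= -!big_distrr /=; ring.
    by move=> t _; ring.
- move=> G fG [G0 [Gt [fG0 fGt tG]]] GN0.
  exists (fun p v => - G0 p v * ((G p v)^-1 * (G p v)^-1)),
    (fun t p v => - Gt t p v * ((G p v)^-1 * (G p v)^-1)); split.
  + by apply: rat_germ_mul; [exact: rat_germ_opp|apply: rat_germ_mul; exact: rat_germ_inv].
  + move=> t; apply: rat_germ_mul; first exact: rat_germ_opp.
    by apply: rat_germ_mul; exact: rat_germ_inv.
  + have := pnear_and tG GN0; apply: pnearS => p v [dG GN] b s r V dV bs Vs bc dVP.
    have dGs := dG _ _ _ _ _ bs Vs bc dVP.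
    apply: is_derive_eq (is_derive1V dGs _) _; rewrite bs Vs//.
    rewrite [in RHS](eq_bigr (fun t => - ((G p v)^-1 * (G p v)^-1) * (Gt t p v * dV t))).
      by rewrite -big_distrr /= expr2 invfM; ring.
    by move=> t _; ring.
- move=> G H fG [G0 [Gt [fG0 fGt tG]]] GH.
  exists G0, Gt; split => //.
  (* Equality at a point does not determine a derivative, so the equality of germs is first spread
     to a neighbourhood of the point. *)
  have := pnear_and tG (pnear_lnear GH); apply: pnearS => p v [dG lGH] b s r V dV bs Vs bc dVP.
  apply: near_eq_is_derive (dG _ _ _ _ _ bs Vs bc dVP).
  apply: (lnear_curve lGH) => //; first exact: (proj1 bc).
  by move=> t; apply: is_derive_continuous (dVP t).
Qed.

End FractionGerms.

(** * Rational germs as quotients of polynomials, and their values along a section *)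

Section PolynomialForm.
Variables (R : realType) (U : riemannSurface R).
Local Notation C := (Cplx R).
Variable T : finType.
Local Notation fiberfun := (U -> (T -> C) -> C).
Implicit Types (p q : U) (v : T -> C) (G H : fiberfun).

(** Several indices may carry the same monomial. Sums and products then only need disjoint unions
    and products of index types; like terms are collected once, when algebraic independence is
    applied. *)
Definition polyfun (I : finType) (F : I -> merofun U) (E : I -> T -> nat) : fiberfun :=
  fun p v => \sum_i mval (F i) p * \prod_t v t ^+ E i t.

Variables (p0 : U) (v0 : T -> C) (K : set (merofun U)).
Hypothesis K_field : mero_subfield K.

Definition poly_germ G := exists (I : finType) (F : I -> merofun U) (E : I -> T -> nat),
  (forall i, K (F i)) /\ pnear p0 v0 (fun p v => G p v = polyfun F E p v).

Lemma regular_near_all (I : finType) (F : I -> merofun U) p : (forall i, K (F i)) ->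
  \forall q \near p^', forall i, regular_at (F i) q.
Proof.
by move=> KF; apply: dnbhs_all => i; apply: meromorphic_regular; exact: msf_mero (KF i).
Qed.

Lemma poly_germ_coef f : K f -> poly_germ (fun p _ => mval f p).
Proof.
move=> Kf; exists unit, (fun=> f), (fun _ _ => 0%N); split => //.
apply: pnear_all => p v; rewrite /polyfun big_const card_unit /= addr0.
by rewrite big1 ?mulr1// => t _; rewrite expr0.
Qed.

Lemma poly_germ_crd t : poly_germ (fun _ v => v t).
Proof.
exists unit, (fun=> mfin (cst 1)), (fun _ t' => (t' == t)%N); split => [_|].
  exact: msf_one.
apply: pnear_all => p v; rewrite /polyfun big_const card_unit /= addr0 mul1r.
rewrite (bigD1 t)//= eqxx expr1 big1 ?mulr1// => t' /negbTE ->.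
by rewrite expr0.
Qed.

Lemma poly_germ_add G H : poly_germ G -> poly_germ H ->
  poly_germ (fun p v => G p v + H p v).
Proof.
move=> [I [F [E [KF GE]]]] [J [F' [E' [KF' HE]]]].
exists (I + J)%type, (fun k => match k with inl i => F i | inr j => F' j end),
  (fun k => match k with inl i => E i | inr j => E' j end); split; first by case.
have := pnear_and GE HE; apply: pnearS => p v [-> ->].
by rewrite /polyfun big_sumType.
Qed.

Lemma poly_germ_mul G H : poly_germ G -> poly_germ H ->
  poly_germ (fun p v => G p v * H p v).
Proof.
move=> [I [F [E [KF GE]]]] [J [F' [E' [KF' HE]]]].
have /choice[M MP] (k : I * J) : exists s, K s /\
    forall p u w, F k.1 p = Some u -> F' k.2 p = Some w -> s p = Some (u * w).
  by have [s Ks sP] := msf_mul K_field (KF k.1) (KF' k.2); exists s.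
exists (I * J)%type, M, (fun k t => E k.1 t + E' k.2 t)%N; split.
  by move=> k; case: (MP k).
have := pnear_and (pnear_and GE HE) (pnear_base v0
  (dnbhs_and (regular_near_all p0 KF) (regular_near_all p0 KF'))).
apply: pnearS => p v [[-> ->] [Fr Fr']].
rewrite /polyfun big_distrlr /= pair_big /=; apply: eq_bigr => -[i j] _ /=.
have [_ /(_ p _ _ (regular_mval (Fr i)) (regular_mval (Fr' j))) /mval_Some ->] := MP (i, j).
rewrite mulrACA -big_split /=; congr (_ * _).
by apply: eq_bigr => t _; rewrite exprD.
Qed.

(** Denominators are cleared by induction. Inversion exchanges [A] and [B], and [A] has no zeros
    because [G = A / B] has none. *)
Lemma rat_germ_quotient G : rat_germ p0 v0 K G -> exists A B, [/\ poly_germ A, poly_germ B &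
  pnear p0 v0 (fun p v => B p v != 0 /\ G p v = A p v / B p v)].
Proof.
have one : poly_germ (fun _ _ => 1) by exact: (poly_germ_coef (msf_one K_field)).
elim=> {G}.
- move=> f Kf; exists (fun p _ => mval f p), (fun _ _ => 1); split => //.
    exact: poly_germ_coef.
  by apply: pnear_all => p v; rewrite oner_neq0 divr1.
- move=> t; exists (fun _ v => v t), (fun _ _ => 1); split => //.
    exact: poly_germ_crd.
  by apply: pnear_all => p v; rewrite oner_neq0 divr1.
- move=> G H _ [A [B [pA pB GE]]] _ [A' [B' [pA' pB' HE]]].
  exists (fun p v => A p v * B' p v + A' p v * B p v), (fun p v => B p v * B' p v).
  split; [by apply: poly_germ_add; apply: poly_germ_mul|exact: poly_germ_mul|].
  have := pnear_and GE HE; apply: pnearS => p v [[B0 ->] [B'0 ->]].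
  by rewrite mulf_neq0// addf_div.
- move=> G H _ [A [B [pA pB GE]]] _ [A' [B' [pA' pB' HE]]].
  exists (fun p v => A p v * A' p v), (fun p v => B p v * B' p v).
  split; [exact: poly_germ_mul|exact: poly_germ_mul|].
  have := pnear_and GE HE; apply: pnearS => p v [[B0 ->] [B'0 ->]].
  by rewrite mulf_neq0// mulf_div.
- move=> G _ [A [B [pA pB GE]]] GN0; exists B, A; split => //.
  have := pnear_and GE GN0; apply: pnearS => p v [[B0 GE'] GN].
  split; last by rewrite GE' invf_div.
  by apply: contraNneq GN => A0; rewrite GE' A0 mul0r.
- move=> G H _ [A [B [pA pB GE]]] GH; exists A, B; split => //.
  have := pnear_and GE GH; apply: pnearS => p v [[B0 GE'] <-].
  by rewrite GE'.
Qed.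

(** Needed for two sections: the graph, with values in [F1], where the identity theorem applies; and
    the constant section [v0], with values in [K], for the converse direction. *)
Lemma rat_germ_value (L : set (merofun U)) (g : T -> U -> C) G : mero_subfield L ->
  K `<=` L -> (forall t, L (mfin (g t))) ->
  (forall t, {for p0, continuous (g t)}) -> (forall t, g t p0 = v0 t) ->
  rat_germ p0 v0 K G ->
  exists2 e, L e & \forall p \near p0^', e p = Some (G p (g^~ p)).
Proof.
move=> LF KL Lg gc g0; elim=> {G}.
- move=> f Kf; exists f; first exact: KL.
  apply: filterS (meromorphic_regular p0 (msf_mero K_field Kf)) => p.
  exact: regular_mval.
- by move=> t; exists (mfin (g t)) => //; exact: nearW.
- move=> G H _ [e Le eE] _ [d Ld dE]; have [s Ls sP] := msf_add LF Le Ld.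
  exists s => //; apply: filterS (dnbhs_and eE dE) => p [ep dp].
  exact: sP.
- move=> G H _ [e Le eE] _ [d Ld dE]; have [s Ls sP] := msf_mul LF Le Ld.
  exists s => //; apply: filterS (dnbhs_and eE dE) => p [ep dp].
  exact: sP.
- move=> G _ [e Le eE] GN0.
  have nE := dnbhs_and eE (pnear_section GN0 gc g0).
  have eN0 : e <> mfin (cst 0).
    move=> e0; have [p []] := dnbhs_nonempty nE.
    by rewrite e0 => -[<-]; rewrite eqxx.
  have [s Ls sP] := msf_inv LF Le eN0.
  by exists s => //; apply: filterS nE => p [ep pN0]; exact: sP.
- move=> G H _ [e Le eE] GH; exists e => //.
  by apply: filterS (dnbhs_and eE (pnear_section GH gc g0)) => p [-> ->].
Qed.

(** Vanishing on the graph around a single p near [p0] suffices: it forces the numerator to vanish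
    there, hence everywhere by independence. *)
Lemma rat_germ_identity (g : T -> U -> C) G :
  (forall (I : finType) (F : I -> merofun U) (E : I -> T -> nat) p1,
    (forall i, K (F i)) -> (\forall p \near p1, polyfun F E p (g^~ p) = 0) ->
    forall p, (forall i, regular_at (F i) p) -> forall v, polyfun F E p v = 0) ->
  (forall t, {for p0, continuous (g t)}) -> (forall t, g t p0 = v0 t) ->
  rat_germ p0 v0 K G ->
  \forall p \near p0^', (\forall q \near p, G q (g^~ q) = 0) ->
    pnear p0 v0 (fun p v => G p v = 0).
Proof.
move=> indep gc g0 /rat_germ_quotient[A [B [[I [F [E [KF AE]]]] _ GE]]].
have := dnbhs_and (pnear_section AE gc g0) (pnear_section GE gc g0).
move=> /dnbhs_near; apply: filterS => p [_ nE] G0.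
have A0 : \forall q \near p, polyfun F E q (g^~ q) = 0.
  apply: filterS (near_and nE G0) => q [[<- [B0 ->]] /eqP].
  by rewrite mulf_eq0 invr_eq0 (negbTE B0) orbF => /eqP.
have := pnear_and (pnear_and AE GE) (pnear_base v0 (regular_near_all p0 KF)).
apply: pnearS => q v [[AEq [_ ->]] Fr].
by rewrite AEq (indep _ _ _ p)// mul0r.
Qed.

End PolynomialForm.

(** * From algebraic independence on the whole surface to a local form *)

Section AlgebraicIndependence.
Variables (R : realType) (U : riemannSurface R) (k n : nat).
Local Notation C := (Cplx R).
Local Notation T := ('I_k + 'I_n)%type.
Implicit Types (p q : U) (v : T -> C).

Definition fiber_coord (w : 'rV[C]_k * 'rV[C]_n) (t : T) : C :=
  match t with inl i => w.1 0 i | inr j => w.2 0 j end.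

Definition fiber_point v : 'rV[C]_k * 'rV[C]_n := (\row_i v (inl i), \row_j v (inr j)).

Definition joint (y : 'I_k -> U -> C) (z : 'I_n -> U -> C) (t : T) : U -> C :=
  match t with inl i => y i | inr j => z j end.

Lemma fiber_coordK w : fiber_point (fiber_coord w) = w.
Proof. by case: w => a b; congr (_, _); apply/rowP => i; rewrite mxE. Qed.

Lemma field_exp (L : set (merofun U)) f d : mero_subfield L -> L f ->
  exists2 s, L s & forall p (u : C), f p = Some u -> s p = Some (u ^+ d).
Proof.
move=> LF Lf; have [s Ls sP] := field_prod (enum 'I_d) LF (fun=> Lf).
exists s => // p u fp; rewrite (sP p (fun=> u))// big_enum /=.
by rewrite prodr_const card_ord.
Qed.

Lemma poly_eval_section (L : set (merofun U)) (g : T -> U -> C) d (P : mpolyfun U k n d) :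
  mero_subfield L -> (forall e e', L (P e e')) -> (forall t, L (mfin (g t))) ->
  exists2 s, L s & forall p, (forall e e', regular_at (P e e') p) ->
    s p = Some (poly_eval P (p, fiber_point (g^~ p))).
Proof.
move=> LF LP Lg.
have Lpow t m : exists s, L s /\ forall p, s p = Some (g t p ^+ m).
  by have [s Ls sP] := field_exp m LF (Lg t); exists s; split => // p; exact: sP.
have term e e' : exists s, L s /\ forall p, regular_at (P e e') p -> s p =
    Some (mval (P e e') p * (\prod_i g (inl i) p ^+ e i) * \prod_j g (inr j) p ^+ e' j).
  have /choice[Y YP] i := Lpow (inl i) (e i).
  have /choice[Z ZP] j := Lpow (inr j) (e' j).
  have [sY LsY sYP] := field_prod (index_enum 'I_k) LF (fun i => (YP i).1).
  have [sZ LsZ sZP] := field_prod (index_enum 'I_n) LF (fun j => (ZP j).1).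
  have [s1 Ls1 s1P] := msf_mul LF (LP e e') LsY.
  have [s2 Ls2 s2P] := msf_mul LF Ls1 LsZ.
  exists s2; split => // p pr; apply: s2P; last by apply: sZP => j; exact: (ZP j).2.
  apply: s1P; first exact: regular_mval.
  by apply: sYP => i; exact: (YP i).2.
have /choice[M MP] (e : {ffun 'I_k -> 'I_d} * {ffun 'I_n -> 'I_d}) := term e.1 e.2.
have [s Ls sP] := field_sum (index_enum _) LF (fun e (_ : xpredT e) => (MP e).1).
exists s => // p pr; rewrite (sP p _ (fun e _ => (MP e).2 p (pr e.1 e.2))).
rewrite /poly_eval pair_big /=; congr Some; apply: eq_bigr => -[e e'] _ /=.
by congr (_ * _ * _); apply: eq_bigr => i _; rewrite mxE.
Qed.

(** [alg_independent] asks for a polynomial that vanishes along the whole graph, whereas only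
    vanishing near [p1] is known. The value along the graph lies in [L], so the identity theorem
    bridges the gap, once like monomials have been collected. *)
Lemma alg_independent_polyfun (K L : set (merofun U)) (y : 'I_k -> U -> C)
    (z : 'I_n -> U -> C) :
  connected [set: U] -> mero_subfield K -> mero_subfield L -> K `<=` L ->
  (forall t, L (mfin (joint y z t))) -> alg_independent K y z ->
  forall (I : finType) (F : I -> merofun U) (E : I -> T -> nat) p1,
    (forall i, K (F i)) ->
    (\forall p \near p1, polyfun F E p ((joint y z)^~ p) = 0) ->
    forall p, (forall i, regular_at (F i) p) -> forall v, polyfun F E p v = 0.
Proof.
move=> Uc KF LF KL Lyz indep I F E p1 KFi F0.
(* The exponents of an [mpolyfun] are strictly below its bound, which is therefore [m.+1]. *)
pose m := \max_(i : I) \max_(t : T) E i t.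
have Em i t : (E i t < m.+1)%N.
  by rewrite ltnS; apply: leq_trans (leq_bigmax i); apply: (leq_bigmax t).
pose ex i : {ffun 'I_k -> 'I_m.+1} * {ffun 'I_n -> 'I_m.+1} :=
  ([ffun j => inord (E i (inl j))], [ffun j => inord (E i (inr j))]).
have Q0 (e : {ffun 'I_k -> 'I_m.+1} * {ffun 'I_n -> 'I_m.+1}) : exists s, K s /\
    forall p, (forall i, regular_at (F i) p) ->
      s p = Some (\sum_(i | ex i == e) mval (F i) p).
  have [s Ks sP] := field_sum (index_enum I) (P := fun i => ex i == e) KF (fun i _ => KFi i).
  by exists s; split => // p pr; apply: sP => i _; exact: regular_mval.
have /choice[Q QP] := Q0.
pose P : mpolyfun U k n m.+1 := fun e e' => Q (e, e').
have PE p v : (forall i, regular_at (F i) p) ->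
    poly_eval P (p, fiber_point v) = polyfun F E p v.
  move=> pr; rewrite /poly_eval pair_big /= /polyfun (partition_big ex xpredT)//=.
  apply: eq_bigr => -[e e'] _ /=; rewrite (mval_Some ((QP (e, e')).2 p pr)).
  rewrite !mulr_suml; apply: eq_bigr => i /eqP -[<- <-].
  rewrite -mulrA big_sumType /=; congr (_ * (_ * _)).
    by apply: eq_bigr => j _; rewrite mxE ffunE inordK.
  by apply: eq_bigr => j _; rewrite mxE ffunE inordK.
have KP e e' : K (P e e') by case: (QP (e, e')).
have [s Ls sP] := poly_eval_section LF (fun e e' => KL _ (KP e e')) Lyz.
have s0 : s = mfin (cst 0).
  apply: (field_identity Uc LF Ls (p := p1)).
  have Preg := dnbhs_all (fun e => dnbhs_all (fun e' =>
    meromorphic_regular p1 (msf_mero KF (KP e e')))).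
  have := dnbhs_and Preg (dnbhs_and (regular_near_all KF p1 KFi) (near_dnbhs F0)).
  apply: filterS => p [Pr [Fr Fp0]].
  by rewrite sP// PE// Fp0.
have P0 := indep _ P KP.
have {}P0 e e' : P e e' = mfin (cst 0).
  apply: P0 => p /sP; rewrite s0 => -[/esym E0].
  exact: E0.
move=> p pr v; rewrite -PE// /poly_eval big1// => e _; rewrite big1// => e' _.
by rewrite P0 /mval /= !mul0r.
Qed.

End AlgebraicIndependence.

(** * Germs of logarithmic type: rational partial derivatives, and regularity over the base point *)

Section LogarithmicGerms.
Variables (R : realType) (U : riemannSurface R) (k n : nat).
Local Notation C := (Cplx R).
Local Notation T := ('I_k + 'I_n)%type.
Local Notation space := (coord_space U k n).
Implicit Types (p q : U) (v : T -> C) (Phi : space -> C).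

Lemma near_fiberP (A : space -> Prop) p v :
  (\forall w \near ((p, fiber_point v) : space), A w) <->
  lnear (fun q v' => A (q, fiber_point v')) p v.
Proof.
split=> [[[N M] [Np [[M1 M2] [HM1 HM2] M12]] NMA]|[e e0 eA]].
  have /nbhs_ballP[e1 /= e10 E1] : nbhs (\row_i v (inl i) : 'rV[C]_k) M1 := HM1.
  have /nbhs_ballP[e2 /= e20 E2] : nbhs (\row_i v (inr i) : 'rV[C]_n) M2 := HM2.
  have cmp : (e1 >=< e2)%R by apply: real_comparable; exact: gtr0_real.
  exists (Num.min e1 e2); first by rewrite comparable_lt_min// e10.
  have {}Np : \forall q \near p, N q by [].
  apply: filterS Np => q Nq v' vv'; apply: NMA; split => //=; apply: M12; split => /=.
  - apply: E1; split => // i j; rewrite !mxE -ball_normE /=.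
    by have := vv' (inl j); rewrite comparable_lt_min// => /andP[].
  - apply: E2; split => // i j; rewrite !mxE -ball_normE /=.
    by have := vv' (inr j); rewrite comparable_lt_min// => /andP[].
exists ([set q | forall v', (forall t, `|v t - v' t| < e) -> A (q, fiber_point v')],
  [set M | forall t, `|v t - fiber_coord M t| < e]); last first.
  by move=> [q M] /= [Hq HM]; have := Hq _ HM; rewrite fiber_coordK.
split => //=.
exists (ball (\row_i v (inl i)) e, ball (\row_j v (inr j)) e); last first.
  move=> [M1 M2] /= [H1 H2] [i|j] /=.
    by have := H1.2 0 i; rewrite -ball_normE /= mxE.
  by have := H2.2 0 j; rewrite -ball_normE /= mxE.
have h1 := nbhsx_ballx (\row_i v (inl i) : 'rV[C]_k) e e0.
have h2 := nbhsx_ballx (\row_j v (inr j) : 'rV[C]_n) e e0.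
by split; [exact: h1|exact: h2].
Qed.

Lemma continuous_sum (S : topologicalType) (I : Type) (r : seq I) (F : I -> S -> C) (a : S) :
  (forall i, {for a, continuous (F i)}) -> {for a, continuous (fun w => \sum_(i <- r) F i w)}.
Proof.
move=> Fc; elim: r => [|i r ih].
  by rewrite /prop_for /continuous_at; under eq_fun do rewrite big_nil;
    rewrite big_nil; exact: cvg_cst.
rewrite /prop_for /continuous_at; under eq_fun do rewrite big_cons;
rewrite big_cons; apply: cvgD ih; exact: Fc.
Qed.

Lemma continuous_prod (S : topologicalType) (I : Type) (r : seq I) (F : I -> S -> C) (a : S) :
  (forall i, {for a, continuous (F i)}) -> {for a, continuous (fun w => \prod_(i <- r) F i w)}.
Proof.
move=> Fc; elim: r => [|i r ih].
  by rewrite /prop_for /continuous_at; under eq_fun do rewrite big_nil;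
    rewrite big_nil; exact: cvg_cst.
rewrite /prop_for /continuous_at; under eq_fun do rewrite big_cons;
rewrite big_cons; apply: cvgM ih; exact: Fc.
Qed.

Lemma continuous_exp (S : topologicalType) (F : S -> C) (a : S) d :
  {for a, continuous F} -> {for a, continuous (fun w => F w ^+ d)}.
Proof.
move=> Fc; elim: d => [|d ih]; first exact: cvg_cst.
rewrite /prop_for /continuous_at; under eq_fun do rewrite exprS.
by rewrite exprS; apply: cvgM ih; exact: Fc.
Qed.

Lemma poly_eval_continuous d (P : mpolyfun U k n d) (a : space) :
  (forall e e', meromorphic (P e e')) -> (forall e e', regular_at (P e e') a.1) ->
  {for a, continuous (poly_eval P)}.
Proof.
move=> Pm Pr; apply: continuous_sum => e; apply: continuous_sum => e'.
rewrite /continuous_at; apply: cvgM; first apply: cvgM.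
- apply: (@continuous_comp _ _ _ fst (mval (P e e'))); first exact: cvg_fst.
  exact/cdiff_at_continuous/meromorphic_cdiff.
- apply: continuous_prod => i; apply: continuous_exp.
  apply: (@continuous_comp _ _ _ (fun w : space => w.2.1) (fun M : 'rV[C]_k => M 0 i)).
    by apply: (@continuous_comp _ _ _ snd fst); [exact: cvg_snd|exact: cvg_fst].
  exact: coord_continuous.
- apply: continuous_prod => i; apply: continuous_exp.
  apply: (@continuous_comp _ _ _ (fun w : space => w.2.2) (fun M : 'rV[C]_n => M 0 i)).
    by apply: (@continuous_comp _ _ _ snd snd); exact: cvg_snd.
  exact: coord_continuous.
Qed.

Definition fiberwise Phi p v := Phi (p, fiber_point v).

Lemma poly_eval_curve_derivable d (P : mpolyfun U k n d) p v :
  (forall e e', meromorphic (P e e')) -> (forall e e', regular_at (P e e') p) ->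
  curve_derivable (fiberwise (poly_eval P)) p v.
Proof.
move=> Pm Pr b s V bs Vs bc hb hV.
apply: derivable1_sum => e; apply: derivable1_sum => e'.
have dP : derivable (fun u => mval (P e e') (b u)) s 1.
  exact: (hb (mval (P e e')) (meromorphic_cdiff (Pm e e') (Pr e e'))).
apply: derivable1M; first apply: (derivable1M dP).
- apply: derivable1_prod => i; under eq_fun do rewrite mxE.
  exact: derivable1X (hV (inl i)).
- apply: derivable1_prod => i; under eq_fun do rewrite mxE.
  exact: derivable1X (hV (inr i)).
Qed.

Variables (x : merofun U) (K : set (merofun U)).
Hypothesis K_fdf : functional_differential_field x K.
Hypothesis x_mero : meromorphic x.
Let K_field := fdf_subfield K_fdf.

Lemma poly_eval_rat_germ d (P : mpolyfun U k n d) p v : (forall e e', K (P e e')) ->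
  rat_germ p v K (fiberwise (poly_eval P)).
Proof.
move=> KP; apply: (rat_germ_sum K_fdf) => e; apply: (rat_germ_sum K_fdf) => e'.
apply: rat_germ_mul; first apply: rat_germ_mul.
- exact: rat_germ_coef.
- apply: (rat_germ_prod K_fdf) => i.
  under eq_fun do under eq_fun do rewrite mxE.
  by apply: (rat_germ_exp K_fdf); exact: rat_germ_crd.
- apply: (rat_germ_prod K_fdf) => i.
  under eq_fun do under eq_fun do rewrite mxE.
  by apply: (rat_germ_exp K_fdf); exact: rat_germ_crd.
Qed.

(** The coefficients are regular at p and the denominator is nonzero there, so the last two claims
    include the fiber over p. Continuity keeps the values of [Rf] inside the domain of a chosen
    branch of the logarithm. *)
Lemma regular_rational_germP p v Rf :
  regular_rational_germ K ((p, fiber_point v) : space) Rf ->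
  [/\ rat_germ p v K (fiberwise Rf), {for ((p, fiber_point v) : space), continuous Rf} &
      lnear (curve_derivable (fiberwise Rf)) p v].
Proof.
move=> [d [P [Q [PQ Q0 RE]]]].
have KP e e' : K (P e e') by case: (PQ e e').
have KQ e e' : K (Q e e') by case: (PQ e e').
have mP e e' := msf_mero K_field (KP e e').
have mQ e e' := msf_mero K_field (KQ e e').
have rP e e' : regular_at (P e e') p by case: (PQ e e').
have rQ e e' : regular_at (Q e e') p by case: (PQ e e').
have cP : {for ((p, fiber_point v) : space), continuous (poly_eval P)}.
  exact: poly_eval_continuous.
have cQ : {for ((p, fiber_point v) : space), continuous (poly_eval Q)}.
  exact: poly_eval_continuous.
have Q0n : \forall w \near ((p, fiber_point v) : space), poly_eval Q w != 0.
  exact: neq_near_continuous cQ Q0.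
have /near_fiberP lQ := Q0n.
have /near_fiberP lE := RE.
split.
- apply: (rat_germ_ext (rat_germ_mul (poly_eval_rat_germ p v KP)
    (rat_germ_inv (poly_eval_rat_germ p v KQ) (lnear_pnear lQ)))).
  by apply: lnear_pnear; apply: lnearS lE => q v'; rewrite /fiberwise => ->.
- have cPQ : {for ((p, fiber_point v) : space),
      continuous (fun w => poly_eval P w / poly_eval Q w)}.
    by rewrite /prop_for /continuous_at; apply: cvgM; [exact: cP|apply: cvgV => //; exact: cQ].
  rewrite /prop_for /continuous_at (nbhs_singleton RE).
  apply: cvg_trans cPQ; apply: near_eq_cvg.
  by apply: filterS RE => w /esym.
- have rn : lnear (fun q (_ : T -> C) => forall e e', regular_at (P e e') q /\
      regular_at (Q e e') q) p v.
    exists 1 => //; have : \forall q \near p, forall e e', regular_at (P e e') q /\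
      regular_at (Q e e') q.
      by apply: near_all => e; apply: near_all => e'; apply: near_and; apply: meromorphic_near.
    by apply: filterS.
  apply: lnearS (lnear_and rn (lnear_and lQ (lnear_self lE))) => q v' [r [Q0' E]].
  apply: (curve_derivable_ext (G := fun q v => poly_eval P (q, fiber_point v) /
    poly_eval Q (q, fiber_point v))); first by apply: lnearS E => ? ? /esym.
  move=> b s V bs Vs bc hb hV.
  have dP := poly_eval_curve_derivable mP (fun e e' => (r e e').1) bs Vs bc hb hV.
  have dQ := poly_eval_curve_derivable mQ (fun e e' => (r e e').2) bs Vs bc hb hV.
  apply: (derivable1M dP); apply: derivable1V dQ.
  by rewrite bs Vs.
Qed.

Lemma ln_branch_near (w : C) (L : C -> C) : ln_branch w L ->
  \forall u \near w, is_derive (u : C) 1 L u^-1.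
Proof.
move=> Lw; have := nbhs_interior Lw; apply: filterS => u Lu.
have [dL _] := nbhs_singleton Lu.
by apply: ln_is_derive => //; apply: filterS Lu => u' [].
Qed.

(** Differentiation turns [ln R] into [dR / R], so the logarithms disappear from all the partial
    derivatives. The second claim keeps control of [Phi] over p itself. *)
Lemma logarithmic_germP p v Phi :
  logarithmic_type K ((p, fiber_point v) : space) Phi ->
  rat_germ_diff p v x K (fiberwise Phi) /\ lnear (curve_derivable (fiberwise Phi)) p v.
Proof.
move=> [m [R0 [Rs [lam [L [rR0 RsP PhiE]]]]]].
have [fR0 _ dR0] := regular_rational_germP rR0.
have fRs i : rat_germ p v K (fiberwise (Rs i)).
  by have [/regular_rational_germP[]] := RsP i.
have lnRs i : lnear (fun q v' => fiberwise (Rs i) q v' != 0 /\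
    is_derive (fiberwise (Rs i) q v') 1 (L i) (fiberwise (Rs i) q v')^-1) p v.
  have [/regular_rational_germP[_ cR _] Rn0 /ln_branch_near lb] := RsP i.
  apply/(near_fiberP (fun w => Rs i w != 0 /\
    is_derive (Rs i w : C) 1 (L i) (Rs i w)^-1)).
  apply: near_and; first exact: neq_near_continuous cR Rn0.
  exact: (continuous_near (A := fun u : C => is_derive u 1 (L i) u^-1) cR lb).
have /near_fiberP lPhi := PhiE.
split.
- have [G0 [Gt [fG0 fGt tG]]] := rat_germ_diffP K_fdf x_mero fR0.
  have /choice[H0 H0P] i := rat_germ_diffP K_fdf x_mero (fRs i).
  have /choice[Ht HP] := H0P.
  have fV i : rat_germ p v K (fun q v' => (fiberwise (Rs i) q v')^-1).
    apply: rat_germ_inv => //; apply: lnear_pnear.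
    by apply: lnearS (lnRs i) => q v' [].
  exists (fun q v' => G0 q v' + \sum_i lam i * ((fiberwise (Rs i) q v')^-1 * H0 i q v')).
  exists (fun t q v' => Gt t q v' + \sum_i lam i * ((fiberwise (Rs i) q v')^-1 * Ht i t q v')).
  split.
  + apply: rat_germ_add => //; apply: (rat_germ_sum K_fdf) => i.
    apply: rat_germ_mul; first exact: (rat_germ_cst _ _ K_fdf).
    by apply: rat_germ_mul => //; case: (HP i).
  + move=> t; apply: rat_germ_add => //; apply: (rat_germ_sum K_fdf) => i.
    apply: rat_germ_mul; first exact: (rat_germ_cst _ _ K_fdf).
    by apply: rat_germ_mul => //; case: (HP i).
  + have tH : pnear p v (fun q v' => forall i,
        diff_along x K (fiberwise (Rs i)) (H0 i) (Ht i) q v').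
      by apply: pnear_forall => i; case: (HP i).
    have lR : pnear p v (fun q v' => forall i,
        fiberwise (Rs i) q v' != 0 /\
        is_derive (fiberwise (Rs i) q v') 1 (L i) (fiberwise (Rs i) q v')^-1).
      by apply: pnear_forall => i; apply: lnear_pnear.
    have := pnear_and (pnear_and tG tH) (pnear_and lR (lnear_pnear (lnear_self lPhi))).
    apply: pnearS => q v' [[dG dH] [lnR E]] b s r V dV bs Vs bc dVP.
    have dR i : is_derive s 1 (fun u => lam i * L i (fiberwise (Rs i) (b u) (V u)))
        (lam i * ((fiberwise (Rs i) q v')^-1 * (H0 i q v' * r + \sum_t Ht i t q v' * dV t))).
      have dL : is_derive (fiberwise (Rs i) (b s) (V s)) 1 (L i) (fiberwise (Rs i) q v')^-1.
        by rewrite bs Vs; case: (lnR i).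
      have dRi := is_derive1_chain (dH i _ _ _ _ _ bs Vs bc dVP) dL.
      apply: is_derive_eq (is_derive1M (is_derive1_cst (lam i) s) dRi) _.
      by rewrite mul0r add0r.
    have := is_derive1D (dG _ _ _ _ _ bs Vs bc dVP)
      (is_derive1_sum (index_enum 'I_m) (fun i (_ : xpredT i) => dR i)).
    move=> dS; have {}dS := is_derive_eq dS (erefl _).
    apply: near_eq_is_derive (is_derive_eq dS _).
      have dVc t : {for s, continuous (V^~ t)} by apply: is_derive_continuous (dVP t).
      have := lnear_curve E bs Vs (proj1 bc) dVc.
      by apply: filterS => u /esym.
    have -> : \sum_t (Gt t q v' +
          \sum_i lam i * ((fiberwise (Rs i) q v')^-1 * Ht i t q v')) * dV t =
        \sum_t Gt t q v' * dV t +
        \sum_i lam i * ((fiberwise (Rs i) q v')^-1 * \sum_t Ht i t q v' * dV t).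
      under eq_bigr do rewrite mulrDl; rewrite big_split /=; congr (_ + _).
      under eq_bigr do rewrite mulr_suml; rewrite exchange_big /=.
      by apply: eq_bigr => i _; rewrite !mulr_sumr; apply: eq_bigr => t _; rewrite !mulrA.
    rewrite mulrDl addrACA; congr (_ + _ + _); rewrite mulr_suml -big_split /=.
    by apply: eq_bigr => i _; rewrite !mulrDr !mulrA.
- have dRs : lnear (fun q v' => forall i, curve_derivable (fiberwise (Rs i)) q v' /\
     derivable (L i) (fiberwise (Rs i) q v') 1) p v.
    apply: lnear_forall => i.
    have [/regular_rational_germP[_ _ dRi] _ _] := RsP i.
    by apply: lnearS (lnear_and dRi (lnRs i)) => q v' [? [_ dLi]].
  apply: lnearS (lnear_and (lnear_self lPhi) (lnear_and dR0 dRs)) => q v' [E [d0 d1]].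
  apply: (curve_derivable_ext (G := fun q v => R0 (q, fiber_point v) +
     \sum_(i < m) lam i * L i (Rs i (q, fiber_point v)))); first by apply: lnearS E => ? ? /esym.
  move=> b s V bs Vs bc hb hV; apply: derivable1D; first exact: (d0 b s V).
  apply: derivable1_sum => i.
  apply: derivable1M; first exact: derivable_cst.
  have [dc dl] := d1 i.
  apply: (@derivable1_comp C (fun u => fiberwise (Rs i) (b u) (V u)) (L i)).
    exact: (dc b s V).
  by rewrite bs Vs.
Qed.

End LogarithmicGerms.

(** * The derivation along the graph, its commutation with translations, and constancy of the
    weighted partials *)

Section LiouvilleExtension.
Variables (R : realType) (U : riemannSurface R).
Local Notation C := (Cplx R).
Hypothesis U_connected : connected [set: U].
Implicit Types p q : U.
Variables (x : merofun U) (K F1 : set (merofun U)).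
Hypotheses (x_mero : meromorphic x) (K_fdf : functional_differential_field x K)
  (F1_fdf : functional_differential_field x F1) (K_sub_F1 : K `<=` F1).
Let K_field := fdf_subfield K_fdf.
Let F1_field := fdf_subfield F1_fdf.

Definition chart_speed (c : chart R U) (p : U) : C :=
  derive1 (mval x \o chart_inv c) (chart_map c p).

Lemma chart_deriv f g p c : meromorphic f -> deriv_at x f g p -> rs_atlas c ->
  chart_dom c p -> regular_at x p -> regular_at f p -> regular_at g p ->
  is_derive (chart_map c p) 1 (mval f \o chart_inv c) (mval g p * chart_speed c p).
Proof.
move=> fm fg ca cp xr fr gr; rewrite /chart_speed -(fg xr fr gr c ca cp).
exact: cdiff_at_is_derive (meromorphic_cdiff fm fr) ca cp.
Qed.

Lemma chart_base_curve c p : rs_atlas c -> chart_dom c p ->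
  base_curve x K (chart_inv c) (chart_map c p) (chart_speed c p).
Proof.
move=> ca cp; split; first exact: chart_inv_cont.
move=> f g Kf Kg fg; rewrite chart_mapK// => xr fr gr.
exact: (chart_deriv (msf_mero K_field Kf) (fg p) ca cp).
Qed.

Lemma constant_base_curve (p : U) (s : C) : base_curve x K (fun=> p) s 0.
Proof.
split; first exact: (@cst_continuous C U p s).
by move=> f g _ _ _ _ _ _; rewrite mulr0; exact: is_derive1_cst.
Qed.

(** The function a is nonzero because it is an exponential where it is finite; differentiating
    [a = expC y] gives [A = a' / a]. *)
Lemma log_tangent a (y : U -> C) p0 : K a -> meromorphic (mfin y) ->
  (forall p u, a p = Some u -> expC (y p) = u) ->
  exists2 A, K A & \forall p \near p0^', regular_at A p /\
    forall c, rs_atlas c -> chart_dom c p ->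
      is_derive (chart_map c p) 1 (y \o chart_inv c) (mval A p * chart_speed c p).
Proof.
move=> Ka ym ya; have am := msf_mero K_field Ka.
have aN0 : a <> mfin (cst 0).
  move=> a0; have := ya p0 0; rewrite a0 => /(_ erefl) /eqP.
  by rewrite (negbTE (expC_neq0 _)).
have [g Kg ag] := fdf_deriv K_fdf Ka.
have [s Ks sP] := msf_inv K_field Ka aN0.
have [A KA AP] := msf_mul K_field Kg Ks.
exists A => //.
have := dnbhs_and (dnbhs_near (meromorphic_regular p0 am))
  (dnbhs_and (meromorphic_regular p0 x_mero) (meromorphic_regular p0 (msf_mero K_field Kg))).
apply: filterS => p [[_ an] [xr gr]].
have ar := nbhs_singleton an.
have ap : mval a p != 0 by rewrite -(ya p _ (regular_mval ar)) expC_neq0.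
have sp := sP _ _ (regular_mval ar) ap.
have Ap := AP _ _ _ (regular_mval gr) sp.
split=> [|c ca cp]; first exact: regular_Some Ap.
have yc : cdiff_at y p by exact: (meromorphic_cdiff ym).
have dy := cdiff_at_is_derive yc ca cp.
have da := chart_deriv am (ag p) ca cp xr ar gr.
have dE := is_derive1_chain dy (is_derive_expC _).
have nE : \forall u \near chart_map c p,
    (mval a \o chart_inv c) u = (@expC R \o (y \o chart_inv c)) u.
  by apply: filterS (chart_inv_near cp an) => u ur /=; rewrite (ya _ _ (regular_mval ur)).
have yp : (y \o chart_inv c) (chart_map c p) = y p by rewrite /= chart_mapK.
have E := is_derive_unique (near_eq_is_derive nE da) dE.
rewrite yp (ya p _ (regular_mval ar)) in E.
apply: is_derive_eq dy _; rewrite (mval_Some Ap) mulrAC E.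
by rewrite mulrAC mulfV// mul1r.
Qed.

Lemma exp_tangent b (z : U -> C) p0 : K b -> (forall p u, b p = Some u -> z p = expC u) ->
  exists2 B, K B & \forall p \near p0^', regular_at B p /\
    forall c, rs_atlas c -> chart_dom c p ->
      is_derive (chart_map c p) 1 (z \o chart_inv c) (mval B p * z p * chart_speed c p).
Proof.
move=> Kb zb; have bm := msf_mero K_field Kb.
have [g Kg bg] := fdf_deriv K_fdf Kb.
exists g => //.
have := dnbhs_and (dnbhs_near (meromorphic_regular p0 bm))
  (dnbhs_and (meromorphic_regular p0 x_mero) (meromorphic_regular p0 (msf_mero K_field Kg))).
apply: filterS => p [[_ bn] [xr gr]].
have br := nbhs_singleton bn.
split=> // c ca cp.
have db := chart_deriv bm (bg p) ca cp xr br gr.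
have dE := is_derive1_chain db (is_derive_expC _).
have nE : \forall u \near chart_map c p,
    (@expC R \o (mval b \o chart_inv c)) u = (z \o chart_inv c) u.
  by apply: filterS (chart_inv_near cp bn) => u ur /=; rewrite -(zb _ _ (regular_mval ur)).
have bp : (mval b \o chart_inv c) (chart_map c p) = mval b p by rewrite /= chart_mapK.
apply: is_derive_eq (near_eq_is_derive nE dE) _.
by rewrite bp -(zb _ _ (regular_mval br)) mulrA [z p * _]mulrC.
Qed.

(** In a chart dh is h' dx, which is zero. The point q replaces p because h' or x may have a pole at
    p. *)
Lemma stationary_constant (h : U -> C) (p : U) : F1 (mfin h) ->
  (\forall q \near p, forall c, rs_atlas c -> chart_dom c q -> chart_speed c q = 0) ->
  exists q : U, \forall r \near q, h r = h q.
Proof.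
move=> Fh x0; have hm := msf_mero F1_field Fh.
have [g Fg hg] := fdf_deriv F1_fdf Fh.
have := dnbhs_and (dnbhs_near (near_dnbhs x0))
  (dnbhs_and (dnbhs_near (meromorphic_regular p x_mero))
             (dnbhs_near (meromorphic_regular p (msf_mero F1_field Fg)))).
move=> /dnbhs_nonempty[q [[_ xq0] [[_ xrq] [_ grq]]]].
exists q; have [c ca cq] := rs_cover q.
have := near_and (chart_inv_near cq (near_and xq0 (near_and xrq grq))) (chart_map_near cq).
move=> /near_normP[r r0 rP].
have H : \forall s \near chart_map c q, h (chart_inv c s) = h q.
  apply/near_normP; exists r => // s sr.
  have -> : h q = (h \o chart_inv c) (chart_map c q) by rewrite /= chart_mapK.
  apply: (ball_constant (F := h \o chart_inv c) r0 _ sr) => u ur.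
  have [[u0 [ux ug]] [cu mu]] := rP _ ur.
  have hr : regular_at (mfin h) (chart_inv c u) by [].
  have := chart_deriv hm (hg (chart_inv c u)) ca cu ux hr ug.
  by rewrite mu (u0 c ca cu) mulr0.
exact: (near_chart_inv (P := fun p => h p = h q) cq H).
Qed.

Variables (T : finType) (g : T -> U -> C).
Hypothesis F1_g : forall t, F1 (mfin (g t)).
Hypothesis indep : forall (I : finType) (F : I -> merofun U) (E : I -> T -> nat) p1,
  (forall i, K (F i)) -> (\forall p \near p1, polyfun F E p (g^~ p) = 0) ->
  forall p, (forall i, regular_at (F i) p) -> forall v, polyfun F E p v = 0.

Let g_cdiff t p : cdiff_at (g t) p.
Proof. exact: (meromorphic_cdiff (msf_mero F1_field (F1_g t))). Qed.

Let g_cont t p : {for p, continuous (g t)}.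
Proof. by apply: cdiff_at_continuous; exact: g_cdiff. Qed.

(** Otherwise the coordinate [t] would be constant near some q, so the polynomial [v t - g t q]
    would vanish on the graph near q, against independence. *)
Lemma speed_nonzero (t : T) (p : U) :
  (\forall q \near p, forall c, rs_atlas c -> chart_dom c q -> chart_speed c q = 0) -> False.
Proof.
move=> /(stationary_constant (F1_g t))[q gq].
pose F (i : bool) : merofun U := mfin (cst (if i then 1 else - g t q)).
pose E (i : bool) (t' : T) : nat := if i then nat_of_bool (t' == t) else 0%N.
have PE p' v : polyfun F E p' v = v t - g t q.
  rewrite /polyfun big_bool /= mul1r; congr (_ + _).
    by rewrite (bigD1 t)//= eqxx expr1 big1 ?mulr1// => t' /negbTE ->; rewrite expr0.
  by rewrite big1 ?mulr1// => t' _; rewrite expr0.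
have : polyfun F E q (fun=> g t q + 1) = 0.
  apply: (@indep bool F E q) => [i||//]; first exact: (fdf_const K_fdf).
  by apply: filterS gq => r; rewrite PE => ->; rewrite subrr.
by rewrite PE addrAC subrr add0r; apply/eqP; rewrite oner_eq0.
Qed.

Variable p0 : U.
Let v0 : T -> C := g^~ p0.
Local Notation pnear := (pnear p0 v0).

(** The value of H on the graph is an element of [F1], so being w near p it is w everywhere; [H - w]
    then vanishes on the graph near [p0], and independence applies. *)
Lemma rat_germ_locally_constant H : rat_germ p0 v0 K H ->
  \forall p \near p0^', forall w, (\forall q \near p, H q (g^~ q) = w) ->
    pnear (fun p v => H p v = w).
Proof.
move=> fH.
have [e Fe eH] := rat_germ_value K_field F1_field K_sub_F1 F1_g (g_cont^~ p0) (fun=> erefl) fH.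
apply: filterS (dnbhs_near eH) => p [_ eHp] w Hw.
have [mw Fmw mwP] := msf_add F1_field Fe (fdf_const F1_fdf (- w)).
have d0 : mw = mfin (cst 0).
  apply: (field_identity U_connected F1_field Fmw (p := p)).
  apply: near_dnbhs; apply: filterS (near_and eHp Hw) => q [eq Hq].
  by rewrite (mwP _ _ _ eq (erefl _)) Hq subrr.
have Hw0 : \forall q \near p0^', H q (g^~ q) - w = 0.
  apply: filterS eH => q eq; have := mwP _ _ _ eq (erefl _).
  by rewrite d0 => -[].
have fHw : rat_germ p0 v0 K (fun p v => H p v - w).
  exact: (rat_germ_sub K_fdf fH (rat_germ_cst p0 v0 K_fdf w)).
have HI := rat_germ_identity K_field indep (g_cont^~ p0) (fun=> erefl) fHw.
have [q [HIq [_ Hq]]] := dnbhs_nonempty (dnbhs_and HI (dnbhs_near Hw0)).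
apply: pnearS (HIq Hq) => p' v /eqP; rewrite subr_eq0.
by move/eqP.
Qed.

(* [mul] marks the exponential coordinates, which are dilated rather than shifted. *)
Variables (A : T -> merofun U) (mul : T -> bool).

Definition weight (t : T) (v : T -> C) : C := if mul t then v t else 1.

Hypothesis KA : forall t, K (A t).
Hypothesis tangent : forall t, \forall p \near p0^', regular_at (A t) p /\
  forall c, rs_atlas c -> chart_dom c p -> is_derive (chart_map c p) 1
    (g t \o chart_inv c) (mval (A t) p * weight t (g^~ p) * chart_speed c p).

Variables (Phi G0 : U -> (T -> C) -> C) (Gt : T -> U -> (T -> C) -> C).
Hypotheses (G0_rat : rat_germ p0 v0 K G0) (Gt_rat : forall t, rat_germ p0 v0 K (Gt t))
  (Phi_diff : tdiff p0 v0 x K Phi G0 Gt).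

(** The derivative of [Phi] along the vector field tangent to the graph, normalised to have
    component 1 in the direction of x. *)
Definition field_derivative p v := G0 p v + \sum_t Gt t p v * (mval (A t) p * weight t v).

Lemma rat_germ_weight t : rat_germ p0 v0 K (fun _ v => weight t v).
Proof. by rewrite /weight; case: (mul t); [exact: rat_germ_crd|exact: rat_germ_cst K_fdf _]. Qed.

Lemma rat_germ_field_derivative : rat_germ p0 v0 K field_derivative.
Proof.
apply: rat_germ_add => //; apply: (rat_germ_sum K_fdf) => t.
apply: rat_germ_mul => //; apply: rat_germ_mul; last exact: rat_germ_weight.
exact: rat_germ_coef.
Qed.

(** This cancels dx. If H were nonzero at a point q of the graph, it would be nonzero around q by
    continuity of its representative in [F1], and dx would vanish on an open set. *)
Lemma near_graph_speed (t : T) H : rat_germ p0 v0 K H ->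
  (\forall p \near p0^', forall c, rs_atlas c -> chart_dom c p ->
     H p (g^~ p) * chart_speed c p = 0) ->
  pnear (fun p v => H p v = 0).
Proof.
move=> fH Hs.
have [e Fe eH] := rat_germ_value K_field F1_field K_sub_F1 F1_g (g_cont^~ p0) (fun=> erefl) fH.
have em := msf_mero F1_field Fe.
have [p [Hc [_ He]]] := dnbhs_nonempty (dnbhs_and (rat_germ_locally_constant fH)
  (dnbhs_near (dnbhs_and eH Hs))).
apply: (Hc 0); have := nbhs_interior He; apply: filterS => q Hq.
have [eq _] := nbhs_singleton Hq.
apply: contrapT => /eqP HN.
have ec : {for q, continuous (mval e)}.
  by apply: cdiff_at_continuous; apply: (meromorphic_cdiff em); exact: regular_Some eq.
have eN : mval e q != 0 by rewrite (mval_Some eq).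
apply: (@speed_nonzero t q).
apply: filterS (near_and Hq (neq_near_continuous ec eN)) => r [[er sr] erN] c ca cr.
have /eqP := sr c ca cr; rewrite mulf_eq0 -(mval_Some er) (negbTE erN) /=.
by move/eqP.
Qed.

Lemma graph_derivative :
  \forall p \near p0^', forall c, rs_atlas c -> chart_dom c p ->
    is_derive (chart_map c p) 1 ((fun q => Phi q (g^~ q)) \o chart_inv c)
      (field_derivative p (g^~ p) * chart_speed c p).
Proof.
have := dnbhs_and (pnear_section Phi_diff (g_cont^~ p0) (fun=> erefl)) (dnbhs_all tangent).
apply: filterS => p [dPhi tang] c ca cp.
pose V u t := g t (chart_inv c u).
have Vp : V (chart_map c p) = g^~ p by rewrite /V chart_mapK.
have := dPhi (chart_inv c) _ _ V _ (chart_mapK cp) Vp (chart_base_curve ca cp)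
  (fun t => (tang t).2 c ca cp).
move=> /is_derive_eq; apply.
rewrite /field_derivative mulrDl mulr_suml; congr (_ + _).
by apply: eq_bigr => t _; rewrite !mulrA.
Qed.

Lemma field_derivative_eq (t : T) f : K f ->
  (\forall p \near p0^', deriv_at x (mfin (fun q => Phi q (g^~ q))) f p) ->
  pnear (fun p v => field_derivative p v = mval f p).
Proof.
move=> Kf df.
have fH : rat_germ p0 v0 K (fun p v => field_derivative p v - mval f p).
  exact: (rat_germ_sub K_fdf rat_germ_field_derivative (rat_germ_coef _ _ Kf)).
apply: pnearS (near_graph_speed t fH _) => [p v /eqP|].
  by rewrite subr_eq0 => /eqP.
have := dnbhs_and (dnbhs_and graph_derivative df)
  (dnbhs_and (meromorphic_regular p0 x_mero) (meromorphic_regular p0 (msf_mero K_field Kf))).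
apply: filterS => p [[dg dfp] [xr fr]] c ca cp.
have hr : regular_at (mfin (fun q => Phi q (g^~ q))) p by [].
have := dfp xr hr fr c ca cp.
rewrite (is_derive_derive1 (dg c ca cp)) => E.
by rewrite mulrBl E subrr.
Qed.

(** For an exponential coordinate this is the dilation by [1 + e], for a logarithm the shift by [e].
    In both cases e = 0 is the identity, with velocity [weight t v]. *)
Definition translate (t : T) (e : C) (v : T -> C) : T -> C :=
  fun t' => v t' + (t' == t)%:R * (e * weight t v).

Lemma translate0 t v : translate t 0 v = v.
Proof. by apply/funext => t'; rewrite /translate mul0r mulr0 addr0. Qed.

(** The translated graph satisfies the same differential equations as the graph: a shift leaves the
    weight 1 unchanged, and a dilation multiplies the coordinate and its weight by the same
    factor. *)
Lemma translate_tangent t e p c : rs_atlas c -> chart_dom c p ->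
  (forall t, is_derive (chart_map c p) 1 (g t \o chart_inv c)
      (mval (A t) p * weight t (g^~ p) * chart_speed c p)) ->
  forall t', is_derive (chart_map c p) 1
    (fun u => translate t e (g^~ (chart_inv c u)) t')
    (mval (A t') p * weight t' (translate t e (g^~ p)) * chart_speed c p).
Proof.
move=> ca cp tang t'; rewrite /translate.
have [->|tt'] := eqVneq t' t; last first.
  under eq_fun do rewrite mul0r addr0.
  by rewrite /weight (negbTE tt') mul0r addr0; exact: tang.
have := tang t; rewrite /weight /= eqxx; case: (mul t) => tg.
  have := is_derive1D tg (is_derive1M (is_derive1_cst 1 _)
    (is_derive1M (is_derive1_cst e (chart_map c p)) tg)).
  move=> /is_derive_eq; apply.
  by rewrite /= !mul0r !add0r; ring.
have := is_derive1D tg (is_derive1_cst (1 * (e * 1)) _).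
by move=> /is_derive_eq; apply; rewrite addr0.
Qed.

Lemma translate_partial t p v : diff_along x K Phi G0 Gt p v ->
  is_derive (0 : C) 1 (fun e => Phi p (translate t e v)) (Gt t p v * weight t v).
Proof.
move=> dPhi.
pose dV t' : C := (t' == t)%:R * weight t v.
have dVP t' : is_derive (0 : C) 1 ((fun e => translate t e v)^~ t') (dV t').
  have := is_derive1D (is_derive1_cst (v t') 0) (is_derive1M (is_derive1_cst (t' == t)%:R 0)
    (is_derive1M (is_derive_id (0 : C) 1) (is_derive1_cst (weight t v) 0))).
  move=> /is_derive_eq; apply.
  by rewrite /dV; ring.
have := dPhi _ _ _ (fun e => translate t e v) dV erefl (translate0 t v)
  (constant_base_curve p 0) dVP.
move=> /is_derive_eq; apply.
rewrite mulr0 add0r (bigD1 t)//= /dV eqxx mul1r big1 ?addr0// => t' /negbTE ->.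
by rewrite mul0r mulr0.
Qed.

(** For each small s, [Phi] at the s-translate of the graph minus [Phi] on the graph is constant
    near a generic p. As functions of s these differences thus agree over neighbouring base points,
    and so do their derivatives at [s = 0], which are the weighted partials. *)
Lemma weighted_partial_constant f t : K f ->
  pnear (fun p v => field_derivative p v = mval f p) ->
  exists w : C, pnear (fun p v => Gt t p v * weight t v = w).
Proof.
move=> Kf Ef.
have fH : rat_germ p0 v0 K (fun p v => Gt t p v * weight t v).
  exact: (rat_germ_mul (Gt_rat t) (rat_germ_weight t)).
have nG := pnear_lnear (pnear_and Phi_diff Ef).
have [p [[Hc [_ tang]] [e e0 eP]]] := dnbhs_nonempty (dnbhs_and
  (dnbhs_and (rat_germ_locally_constant fH) (dnbhs_near (dnbhs_all tangent)))
  (pnear_section nG (g_cont^~ p0) (fun=> erefl))).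
exists (Gt t p (g^~ p) * weight t (g^~ p)); apply: Hc.
(* [M] bounds the weight near p, so a translation with parameter below [d] moves the fiber by less
   than [e / 2]; the other half of [e] absorbs the variation of the graph. One [d] thus serves all
   base points near p. *)
pose M : C := `|weight t (g^~ p)| + 1.
have M0 : 0 < M by rewrite ltr_wpDl.
pose d : C := e / 2 / M.
have e20 : 0 < e / 2 by rewrite divr_gt0.
have d0 : 0 < d by rewrite divr_gt0.
have wM : \forall q \near p, `|weight t (g^~ q)| < M.
  rewrite /M /weight; case: (mul t).
    have h : \forall u \near g t p, `|u| < `|g t p| + 1.
      apply/near_normP; exists 1 => // u; rewrite distrC => up.
      rewrite -[u](subrK (g t p)) addrC.
      by apply: le_lt_trans (ler_normD _ _) _; rewrite ltrD2l.
    exact: continuous_near (@g_cont t p) h.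
  by apply: nearW => q; rewrite normr1 ltrDl.
have gn := near_section e20 (g_cont^~ p) (fun=> erefl).
have good : \forall q \near p, forall s : C, `|s| < d ->
    diff_along x K Phi G0 Gt q (translate t s (g^~ q)) /\
    field_derivative q (translate t s (g^~ q)) = mval f q.
  apply: filterS (near_and eP (near_and wM gn)) => q [Pq [wq gq]] s sd; apply: Pq => t'.
  rewrite /translate opprD addrA [e]splitr.
  apply: le_lt_trans (ler_normB _ _) _; apply: ltr_leD; first exact: gq.
  case: (t' == t); last by rewrite mul0r normr0 ltW.
  rewrite mul1r normrM; apply: le_trans (_ : d * M <= _).
    by apply: ler_pM => //; exact: ltW.
  by rewrite /d divfK ?gt_eqF.
have [c ca cp] := rs_cover p.
have := near_and (chart_inv_near cp (near_and good tang)) (chart_map_near cp).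
move=> /near_normP[r r0 rP].
pose D s (u : C) := Phi (chart_inv c u) (translate t s (g^~ (chart_inv c u))) -
  Phi (chart_inv c u) (translate t 0 (g^~ (chart_inv c u))).
(* Both the translated and the original graph give [Phi] the derivative f dx, so the difference has
   derivative zero on the chart ball. *)
have DE s : `|s| < d -> forall u, `|chart_map c p - u| < r -> D s u = D s (chart_map c p).
  move=> sd; apply: (ball_constant r0) => u ur.
  have [[gd tg] [cu mu]] := rP _ ur.
  have dT s' : `|s'| < d -> is_derive u 1
      (fun u => Phi (chart_inv c u) (translate t s' (g^~ (chart_inv c u))))
      (mval f (chart_inv c u) * chart_speed c (chart_inv c u)).
    move=> /gd[dPhi <-].
    have tg' := translate_tangent t s' ca cu (fun t => (tg t).2 c ca cu).
    have bc := chart_base_curve ca cu.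
    rewrite mu in tg' bc.
    have := dPhi (chart_inv c) u _ (fun u => translate t s' (g^~ (chart_inv c u))) _
      erefl erefl bc tg'.
    move=> /is_derive_eq; apply.
    rewrite /field_derivative mulrDl mulr_suml; congr (_ + _).
    by apply: eq_bigr => t' _; rewrite !mulrA.
  have := is_derive1B (dT s sd) (dT 0 _); rewrite normr0 d0 => /(_ isT) /is_derive_eq; apply.
  by rewrite subrr.
apply: (near_chart_inv (P := fun q => Gt t q (g^~ q) * weight t (g^~ q) =
  Gt t p (g^~ p) * weight t (g^~ p)) cp).
apply/near_normP; exists r => // u ur.
have [[gd _] _] := rP _ ur.
have pr : `|chart_map c p - chart_map c p| < r by rewrite subrr normr0.
have [[gdp _] _] := rP _ pr.
rewrite chart_mapK// in gdp.
have n0 : `|0 : C| < d by rewrite normr0.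
have := (gd 0 n0).1; rewrite translate0 => /(translate_partial t) d1.
have := (gdp 0 n0).1; rewrite translate0 => /(translate_partial t) d2.
have d1' := is_derive1B d1 (is_derive1_cst (Phi (chart_inv c u) (g^~ (chart_inv c u))) 0).
have d2' := is_derive1B d2 (is_derive1_cst (Phi p (g^~ p)) 0).
have E : \forall s \near (0 : C),
   Phi (chart_inv c u) (translate t s (g^~ (chart_inv c u))) -
     Phi (chart_inv c u) (g^~ (chart_inv c u)) =
   Phi p (translate t s (g^~ p)) - Phi p (g^~ p).
  apply/near_normP; exists d => // s; rewrite sub0r normrN => sd.
  by have := DE s sd u ur; rewrite /D !translate0 chart_mapK.
have := is_derive_unique (near_eq_is_derive E d1') d2'.
by rewrite !subr0.
Qed.

End LiouvilleExtension.

(** * Integration of constant weighted partials inside the fibers *)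

Section VerticalIntegration.
Variables (R : realType) (U : riemannSurface R).
Local Notation C := (Cplx R).
Variables (x : merofun U) (K : set (merofun U)).
Variables (T : finType) (p0 : U) (v0 : T -> C) (mul : T -> bool).
Hypothesis v0_neq0 : forall t, mul t -> v0 t != 0.
Variable Ln : C -> C.
Hypotheses (Ln_branch : ln_branch 1 Ln) (Ln1 : Ln 1 = 0).
Implicit Types (p q : U) (v : T -> C).

(** The primitive of [1 / weight] that vanishes at [v0]. *)
Definition log_coord (t : T) (v : T -> C) : C :=
  if mul t then Ln (v t / v0 t) else v t - v0 t.

Lemma log_coord_base t : log_coord t v0 = 0.
Proof. by rewrite /log_coord; case: ifP => [/v0_neq0 h|_]; rewrite ?subrr// mulfV. Qed.

(** The quotient [v t / v0 t] is 1 at [v0], where [Ln] is a branch of the logarithm. The filter is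
    left free because both punctured and full neighbourhoods of [p0] are needed. *)
Lemma near_log_coord F : Filter F -> fiber_near F v0 (fun (p : U) v => forall t,
  weight mul t v != 0 /\
  forall (V : C -> T -> C) (s dV : C), V s = v -> is_derive s 1 (V^~ t) dV ->
    is_derive s 1 (fun u => log_coord t (V u)) (dV / weight mul t v)).
Proof.
move=> FF; apply: fiber_near_forall => t; rewrite /weight /log_coord.
case: (boolP (mul t)) => mt; last first.
  exists 1 => //; apply: nearW => p v _; split; first exact: oner_neq0.
  move=> V s dV _ dVt; apply: is_derive_eq (is_derive1B dVt (is_derive1_cst (v0 t) s)) _.
  by rewrite subr0 divr1.
have v0t := v0_neq0 mt.
have dc : is_derive (v0 t) 1 (fun u : C => u / v0 t) ((v0 t)^-1).
  have := is_derive1M (is_derive_id (v0 t) 1) (is_derive1_cst (v0 t)^-1 (v0 t)).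
  by move=> /is_derive_eq; apply; rewrite mul1r mulr0 addr0.
have vc := is_derive_continuous dc.
have h1 : \forall u \near v0 t / v0 t, is_derive (u : C) 1 Ln u^-1.
  by rewrite mulfV//; exact: ln_branch_near.
have h2 := continuous_near vc h1.
have n1 : v0 t / v0 t != 0 by rewrite mulfV ?oner_neq0.
have /near_normP[e e0 eP] := near_and h2 (neq_near_continuous vc n1).
exists e => //; apply: nearW => p v /(_ t) /eP[dL vN]; split.
  by apply: contraNneq vN => ->; rewrite mul0r.
move=> V s dV Vs dVt.
have dVt' := is_derive1M dVt (is_derive1_cst (v0 t)^-1 s).
have dL' : is_derive (V s t / v0 t) 1 Ln (v t / v0 t)^-1 by rewrite Vs.
apply: is_derive_eq (is_derive1_chain dVt' dL') _.
by rewrite mulr0 addr0 invf_div mulrC mulrA divfK.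
Qed.

Variables (Phi G0 : U -> (T -> C) -> C) (Gt : T -> U -> (T -> C) -> C) (w : T -> C).
Hypotheses (Phi_diff : tdiff p0 v0 x K Phi G0 Gt)
  (partials : forall t, pnear p0 v0 (fun p v => Gt t p v * weight mul t v = w t))
  (Phi_curve : lnear (curve_derivable Phi) p0 v0).

(** Along the segment from [v0] to v over a fixed p, [Gt t] equals [w t / weight], so the two sides
    have the same derivative. *)
Lemma vertical_integration_punctured :
  pnear p0 v0 (fun p v => Phi p v = Phi p v0 + \sum_t w t * log_coord t v).
Proof.
have [e e0 eP] := pnear_and Phi_diff (pnear_and (pnear_forall partials)
  (near_log_coord (dnbhs_filter p0))).
exists e => //; apply: filterS eP => p eP v vP.
pose V u t := v0 t + u * (v t - v0 t).
pose F u := Phi p (V u) - \sum_t w t * log_coord t (V u).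
have V0 : V 0 = v0 by apply/funext => t; rewrite /V mul0r addr0.
have V1 : V 1 = v by apply/funext => t; rewrite /V mul1r addrC subrK.
have : F 1 = F 0.
  apply: segment_constant => r /andP[r0 r1].
  have /eP[dPhi [Gw dlog]] : forall t, `|v0 t - V r%:C%C t| < e.
    move=> t; rewrite /V opprD addNKr normrN normrM.
    apply: le_lt_trans (vP t); rewrite distrC -[leRHS]mul1r.
    rewrite ler_wpM2r// normc_def /= expr0n /= addr0 sqrtr_sqr ger0_norm//.
    by rewrite (lecR _ 1).
  have dV t : is_derive (r%:C%C : C) 1 (V^~ t) (v t - v0 t).
    have := is_derive1D (is_derive1_cst (v0 t) _) (is_derive1M (is_derive_id (r%:C%C : C) 1)
      (is_derive1_cst (v t - v0 t) _)).
    by move=> /is_derive_eq; apply; rewrite add0r mul1r mulr0 addr0.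
  have dP := dPhi _ _ _ V _ erefl erefl (constant_base_curve x K p (r%:C%C : C)) dV.
  have dS := is_derive1_sum (index_enum T) (fun t (_ : xpredT t) =>
    is_derive1M (is_derive1_cst (w t) (r%:C%C : C)) ((dlog t).2 V _ _ erefl (dV t))).
  have := is_derive1B dP dS; move=> /is_derive_eq; apply.
  apply/eqP; rewrite mulr0 add0r subr_eq0; apply/eqP; apply: eq_bigr => t _.
  rewrite mul0r add0r -(Gw t); have := (dlog t).1.
  by move: (weight mul t _) => W WN0; rewrite mulrACA mulfV// mulr1.
rewrite /F V0 V1 => /eqP; rewrite subr_eq => /eqP ->.
by under [X in _ - X]eq_bigr do rewrite log_coord_base mulr0; rewrite big1 ?subr0.
Qed.

Lemma curve_derivable_section v : curve_derivable Phi p0 v ->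
  {for p0, continuous (Phi^~ v)}.
Proof.
move=> cd; have [c ca cp] := rs_cover p0.
have := cd (chart_inv c) (chart_map c p0) (fun=> v) (chart_mapK cp) erefl
  (chart_inv_cont cp) (fun h hp => hp c ca cp) (fun t => derivable_cst _ _ _).
move=> /derivable_is_derive1 /is_derive_continuous hc A Ap.
suff : \forall q \near p0, A (Phi q v) by [].
apply: (near_chart_inv (P := fun q => A (Phi q v)) cp).
apply: (continuous_near (A := A) hc); rewrite /= chart_mapK//.
Qed.

(** Only the fiber over [p0] is missing; for fixed v both [Phi p v] and [Phi p v0] are continuous in
    p at [p0], and the sum does not depend on p. *)
Lemma vertical_integration :
  lnear (fun p v => Phi p v = Phi p v0 + \sum_t w t * log_coord t v) p0 v0.
Proof.
have [e e0 eP] := vertical_integration_punctured.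
have [d d0 dP] := Phi_curve.
have cmp : (e >=< d)%R by apply: real_comparable; exact: gtr0_real.
have m0 : 0 < Num.min e d by rewrite comparable_lt_min// e0.
have mle z : z < Num.min e d -> z < e /\ z < d.
  by rewrite comparable_lt_min// => /andP.
have cd v : (forall t, `|v0 t - v t| < Num.min e d) -> curve_derivable Phi p0 v.
  by move=> vP; apply: (nbhs_singleton dP) => t; case: (mle _ (vP t)).
exists (Num.min e d) => //.
have := eP; rewrite near_withinE; apply: filterS => p eP' v vP.
have vPe t : `|v0 t - v t| < e by case: (mle _ (vP t)).
have [->|/eP' H] := eqVneq p p0; last exact: H.
have v0P : forall t, `|v0 t - v0 t| < Num.min e d by move=> t; rewrite subrr normr0.
have Dc : {for p0, continuous (fun p => Phi p v - Phi p v0)}.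
  rewrite /prop_for /continuous_at; apply: cvgB.
    exact: (curve_derivable_section (cd v vP)).
  exact: (curve_derivable_section (cd v0 v0P)).
have H : \forall q \near p0^', Phi q v - Phi q v0 = \sum_t w t * log_coord t v.
  by apply: filterS eP => q /(_ v vPe) ->; rewrite addrAC subrr add0r.
by rewrite -(dnbhs_cst_cont Dc H) addrC subrK.
Qed.

End VerticalIntegration.

(** * The converse: the separated form restricts to an integral over K *)

Section SeparatedGerm.
Variables (R : realType) (U : riemannSurface R).
Local Notation C := (Cplx R).
Variables (x : merofun U) (K : set (merofun U)).
Hypothesis K_fdf : functional_differential_field x K.
Let K_field := fdf_subfield K_fdf.
Variables (T : finType) (g : T -> U -> C) (p0 : U) (mul : T -> bool).
Let v0 : T -> C := g^~ p0.
Hypotheses (g_cdiff : forall t p, cdiff_at (g t) p) (v0_neq0 : forall t, mul t -> v0 t != 0).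
Variables (Ln : C -> C) (A : T -> merofun U).
Hypotheses (Ln_branch : ln_branch 1 Ln) (KA : forall t, K (A t)).
Hypothesis tangent : forall t, \forall p \near p0^', regular_at (A t) p /\
  forall c, rs_atlas c -> chart_dom c p -> is_derive (chart_map c p) 1
    (g t \o chart_inv c) (mval (A t) p * weight mul t (g^~ p) * chart_speed x c p).
Variables (Phi G0 : U -> (T -> C) -> C) (Gt : T -> U -> (T -> C) -> C) (w : T -> C).
Hypotheses (G0_rat : rat_germ p0 v0 K G0) (Phi_diff : tdiff p0 v0 x K Phi G0 Gt)
  (Phi_curve : lnear (curve_derivable Phi) p0 v0).

Let g_cont t (p : U) : {for p, continuous (g t)}.
Proof. by apply: cdiff_at_continuous; exact: g_cdiff. Qed.

Lemma graph_cdiff : \forall p \near p0, cdiff_at (fun q => Phi q (g^~ q)) p.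
Proof.
apply: filterS (lnear_section Phi_curve (g_cont^~ p0) (fun=> erefl)) => p cd c ca cp.
apply: (cd (chart_inv c) (chart_map c p) (fun u t => g t (chart_inv c u)) (chart_mapK cp) _
  (chart_inv_cont cp) (fun h hp => hp c ca cp)).
  by rewrite chart_mapK.
by move=> t; exact: (g_cdiff ca cp).
Qed.

Lemma separated_integral :
  lnear (fun p v => Phi p v = Phi p v0 + \sum_t w t * log_coord v0 mul Ln t v) p0 v0 ->
  germ_of_integral x K (fun p => Phi p (g^~ p)) p0.
Proof.
move=> sep; split; first exact: graph_cdiff.
(* The derivative in x of [Phi(p, v0)] is [G0(p, v0)]. It lies in K, since the constants [v0 t]
   do. *)
have [e Ke eG] := rat_germ_value K_field K_field (@subset_refl _ K)
  (fun t => fdf_const K_fdf (v0 t)) (fun t => @cst_continuous U C (v0 t) p0)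
  (fun=> erefl) G0_rat.
have Kterm t : exists s, K s /\ forall p, regular_at (A t) p -> s p = Some (w t * mval (A t) p).
  have [s Ks sP] := msf_mul K_field (fdf_const K_fdf (w t)) (KA t).
  by exists s; split => // p /regular_mval ar; exact: sP.
have /choice[B BP] := Kterm.
have [S KS SP] := field_sum (index_enum T) (P := xpredT) K_field (fun t _ => (BP t).1).
have [f Kf fP] := msf_add K_field Ke KS.
exists f => //.
have hsep := near_dnbhs (lnear_section sep (g_cont^~ p0) (fun=> erefl)).
have Phi0 := pnear_section Phi_diff (g := fun t _ => v0 t)
  (fun t => @cst_continuous U C (v0 t) p0) (fun=> erefl).
have hlog := lnear_section (near_log_coord v0_neq0 Ln_branch (nbhs_filter p0))
  (g_cont^~ p0) (fun=> erefl).
have := dnbhs_and (dnbhs_and (dnbhs_near hsep) (dnbhs_all tangent))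
  (dnbhs_and (dnbhs_and eG Phi0) (near_dnbhs hlog)).
apply: filterS => p [[[_ sp] tang] [[ep dPhi] lp]] xr hr fr c ca cp.
(* The logarithmic coordinate [t] has derivative [A t] along the graph: its factor [1 / weight]
   cancels the weight in the tangent. *)
have fp : mval f p = G0 p v0 + \sum_t w t * mval (A t) p.
  apply: mval_Some; apply: fP => //; apply: SP => t _.
  by apply: (BP t).2; case: (tang t).
rewrite fp -/(chart_speed x c p); apply: is_derive_derive1.
pose V u t := g t (chart_inv c u).
have Vp : V (chart_map c p) = g^~ p by rewrite /V chart_mapK.
have d1 := dPhi (chart_inv c) _ _ (fun=> v0) (fun=> 0) (chart_mapK cp) erefl
  (chart_base_curve K_fdf ca cp) (fun t => is_derive1_cst _ _).
have d2 := is_derive1_sum (index_enum T) (fun t (_ : xpredT t) =>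
  is_derive1M (is_derive1_cst (w t) _) ((lp t).2 V _ _ Vp ((tang t).2 c ca cp))).
have E : \forall u \near chart_map c p,
    Phi (chart_inv c u) v0 + \sum_t w t * log_coord v0 mul Ln t (V u) =
    (mval (mfin (fun q => Phi q (g^~ q))) \o chart_inv c) u.
  by apply: filterS (chart_inv_near cp sp) => u /esym.
apply: near_eq_is_derive E _; apply: is_derive_eq (is_derive1D d1 d2) _.
rewrite [X in _ + X + _]big1 ?addr0 => [|t _]; last by rewrite mulr0.
rewrite mulrDl mulr_suml; congr (_ + _); apply: eq_bigr => t _.
rewrite mul0r add0r; have := (lp t).1.
by move: (weight mul t _) => W WN0; rewrite -!mulrA [W * _]mulrCA mulfV// mulr1.
Qed.

End SeparatedGerm.

Lemma adjoined_tangents (R : realType) (U : riemannSurface R) (x : merofun U)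
  (K : set (merofun U)) (x_mero : meromorphic x)
  (K_fdf : functional_differential_field x K) (k n : nat)
  (a : 'I_k -> merofun U) (a_in_K : forall i, K (a i))
  (b : 'I_n -> merofun U) (b_in_K : forall j, K (b j))
  (y : 'I_k -> U -> Cplx R) (z : 'I_n -> U -> Cplx R)
  (y_mero : forall i, meromorphic (mfin (y i)))
  (y_log : forall i p u, a i p = Some u -> expC (y i p) = u)
  (z_exp : forall j p u, b j p = Some u -> z j p = expC u) (p0 : U)
  (mul := fun t : 'I_k + 'I_n => if t is inr _ then true else false) :
  exists A : 'I_k + 'I_n -> merofun U, (forall t, K (A t)) /\
    forall t, \forall p \near p0^', regular_at (A t) p /\
      forall c, rs_atlas c -> chart_dom c p -> is_derive (chart_map c p) 1
        (joint y z t \o chart_inv c)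
        (mval (A t) p * weight mul t ((joint y z)^~ p) * chart_speed x c p).
Proof.
suff H t : exists A, K A /\ \forall p \near p0^', regular_at A p /\
      forall c, rs_atlas c -> chart_dom c p -> is_derive (chart_map c p) 1
        (joint y z t \o chart_inv c)
        (mval A p * weight mul t ((joint y z)^~ p) * chart_speed x c p).
  by have /choice[A AP] := H; exists A; split => t; case: (AP t).
case: t => [i|j].
- have [A KA AP] := log_tangent x_mero K_fdf p0 (a_in_K i) (y_mero i) (y_log i).
  exists A; split => //; apply: filterS AP => p [Ar dA]; split => // c ca cp.
  by rewrite /weight /= mulr1; exact: dA.
- have [B KB BP] := exp_tangent x_mero K_fdf p0 (b_in_K j) (z_exp j).
  by exists B; split => //; apply: filterS BP => p [Br dB].
Qed.

Unset Implicit Arguments.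
Set Strict Implicit.
Set Printing Implicit Defensive.

Theorem theorem7 (R : realType) (U : riemannSurface R)
  (U_connected : connected [set: U])
  (x : merofun U) (x_mero : meromorphic x) (x_nonconstant : nonconstant x)
  (K F1 : set (merofun U))
  (K_field : functional_differential_field x K)
  (F1_field : functional_differential_field x F1)
  (K_sub_F1 : K `<=` F1)
  (k n : nat)
  (a : 'I_k -> merofun U) (a_in_K : forall i, K (a i))
  (b : 'I_n -> merofun U) (b_in_K : forall j, K (b j))
  (* y and z are finite everywhere and z has no zero: this is the map
     gamma : U -> C^k x (C^* )^n *)
  (y : 'I_k -> U -> Cplx R) (z : 'I_n -> U -> Cplx R)
  (y_mero : forall i, meromorphic (mfin (y i)))
  (z_mero : forall j, meromorphic (mfin (z j)))
  (z_neq0 : forall j p, z j p != 0)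
  (y_log : forall i p u, a i p = Some u -> expC (y i p) = u)
  (z_exp : forall j p u, b j p = Some u -> z j p = expC u)
  (F1_adj : obtained_by_adjoining K
     [set f | (exists i, f = mfin (y i)) \/ (exists j, f = mfin (z j))] F1)
  (yz_indep : alg_independent K y z)
  (p0 : U)
  (Phi : coord_space U k n -> Cplx R)
  (Phi_log : logarithmic_type K (p0, graph_map y z p0) Phi)
  (* the branch of ln at 1 with ln 1 = 0 *)
  (Ln : Cplx R -> Cplx R) (Ln_branch : ln_branch 1 Ln) (Ln1 : Ln 1 = 0) :
  germ_of_integral x K (fun p => Phi (p, graph_map y z p)) p0 <->
  exists (c : 'I_k -> Cplx R) (t : 'I_n -> Cplx R),
    \forall w \near ((p0, graph_map y z p0) : coord_space U k n),
      Phi w = Phi (w.1, graph_map y z p0)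
              + \sum_(i < k) c i * (w.2.1 0 i - y i p0)
              + \sum_(j < n) t j * Ln (w.2.2 0 j / z j p0).
Proof.
pose T := ('I_k + 'I_n)%type.
pose g : T -> U -> Cplx R := joint y z.
pose v0 : T -> Cplx R := g^~ p0.
pose mul (t : T) := if t is inr _ then true else false.
have K_sf := fdf_subfield K_field.
have F1_sf := fdf_subfield F1_field.
have F1_g t : F1 (mfin (g t)).
  case: F1_adj => _ _ SF _; apply: SF.
  by case: t => [i|j]; [left; exists i|right; exists j].
have indep := alg_independent_polyfun U_connected K_sf F1_sf K_sub_F1 F1_g yz_indep.
have g_cdiff t p : cdiff_at (g t) p by exact: (meromorphic_cdiff (msf_mero F1_sf (F1_g t))).
have v0_neq0 t : mul t -> v0 t != 0 by case: t => //= j _; exact: z_neq0.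
have [A [KA tangent]] := adjoined_tangents x_mero K_field a_in_K b_in_K y_mero y_log z_exp p0.
(* [graph_map y z p0] is [fiber_point v0] by conversion. *)
have [[G0 [Gt [G0_rat Gt_rat Phi_diff]]] Phi_curve] :=
  logarithmic_germP K_field x_mero (v := v0) Phi_log.
split=> [[_ [f Kf df]]|[c [t sep]]].
(* The index [m] also supplies the coordinate needed to exclude that dx vanishes on an open set; if
   [k = n = 0] there is no constant to find. *)
- have ex_w m : exists w : Cplx R, pnear p0 v0 (fun p v => Gt m p v * weight mul m v = w).
    have dE := field_derivative_eq U_connected x_mero K_field F1_field K_sub_F1 F1_g indep KA
      tangent G0_rat Gt_rat Phi_diff m Kf df.
    exact: (weighted_partial_constant U_connected K_field F1_field K_sub_F1 F1_g indep
      tangent Gt_rat Phi_diff m Kf dE).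
  have /choice[w partials] := ex_w.
  exists (w \o inl), (w \o inr).
  apply/(near_fiberP (fun w' => Phi w' = Phi (w'.1, graph_map y z p0)
              + \sum_(i < k) w (inl i) * (w'.2.1 0 i - y i p0)
              + \sum_(j < n) w (inr j) * Ln (w'.2.2 0 j / z j p0)) p0 v0).
  have VI := vertical_integration v0_neq0 Ln_branch Ln1 Phi_diff partials Phi_curve.
  apply: lnearS VI.
  move=> p v; rewrite /fiberwise => ->; rewrite -addrA big_sumType /=.
  congr (_ + (_ + _)).
    by apply: eq_bigr => i _; rewrite mxE.
  by apply: eq_bigr => j _; rewrite mxE.
- pose w (m : T) := match m with inl i => c i | inr j => t j end.
  have := separated_integral K_field g_cdiff v0_neq0 Ln_branch KA tangent (w := w)
    G0_rat Phi_diff Phi_curve; apply.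
  have := proj1 (near_fiberP (fun w' => Phi w' = Phi (w'.1, graph_map y z p0)
              + \sum_(i < k) c i * (w'.2.1 0 i - y i p0)
              + \sum_(j < n) t j * Ln (w'.2.2 0 j / z j p0)) p0 v0) sep.
  apply: lnearS => p v; rewrite /fiberwise => ->; rewrite -addrA big_sumType /=.
  congr (_ + (_ + _)).
    by apply: eq_bigr => i _; rewrite mxE.
  by apply: eq_bigr => j _; rewrite mxE.
Qed.
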